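(* Let $G$ be a balanced bipartite graph on $2n$ vertices. If $\alpha_{\mathrm{BIP}}(G) \leq 2\delta(G) - 24$, then $\mathcal{C}_{2n}(G) = \mathcal{C}(G)$.
   Context: Graphs are finite and simple. $\delta(G)$ is the minimum degree of $G$. A bipartite graph $G = (X \cup Y, E)$ with parts $X, Y$ is balanced if $|X| = |Y|$. For such a graph, an independent set $A \subseteq X \cup Y$ is balanced if $|A \cap X| = |A \cap Y|$, and the balanced independence number $\alpha_{\mathrm{BIP}}(G)$ is the largest size $|A|$ of a balanced independent set $A$ in $G$. The cycle space $\mathcal{C}(G)$ is the vector space over $\mathbb{F}_2$ spanned by the incidence vectors (in $\mathbb{F}_2^{E(G)}$) of the edge-sets of all cycles of $G$; $\mathcal{C}_{2n}(G)$ is the subspace of $\mathcal{C}(G)$ spanned by the incidence vectors of the edge-sets of cycles of length $2n$ in $G$, i.e. of Hamilton cycles of $G$ when $G$ has $2n$ vertices. *)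

(* Defs.v *)
From mathcomp Require Import all_boot all_order all_algebra.

Set Implicit Arguments.
Unset Strict Implicit.
Unset Printing Implicit Defensive.

Import GRing.Theory.

(* A simple graph is a symmetric irreflexive relation [e] on a finite type
   [T]; symmetry and irreflexivity are hypotheses of the theorem. *)

Section SimpleGraph.
Variables (T : finType) (e : rel T).

Definition degree (x : T) : nat := #|[set y | e x y]|.

(* Every degree is at most #|T|, so the default value #|T| never affects the
   minimum when [T] is inhabited. *)
Definition min_degree : nat := \big[minn/#|T|]_(x : T) degree x.

Definition independent (A : {set T}) : bool :=
  [forall x in A, forall y in A, ~~ e x y].

Definition bipartite (X Y : {set T}) : bool :=
  [&& X :|: Y == [set: T], [disjoint X & Y], independent X & independent Y].

Definition balanced_bipartite (X Y : {set T}) : bool :=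
  bipartite X Y && (#|X| == #|Y|).

Definition alpha_BIP (X Y : {set T}) : nat :=
  \max_(A : {set T} | independent A && (#|A :&: X| == #|A :&: Y|)) #|A|.

Definition edges : {set {set T}} :=
  [set d : {set T} | [exists x, exists y, e x y && (d == [set x; y])]].

Definition edge : finType := {d : {set T} | d \in edges}.

Definition edge_space : vectType 'F_2 := {ffun edge -> ('F_2)^o}.

(* [c] lists the vertices of a cycle in cyclic order; [size c] is both the
   number of vertices and the number of edges of the cycle. *)
Definition is_cycle (c : seq T) : bool := (2 < size c) && ucycleb e c.

Definition cycle_edges (c : seq T) : {set {set T}} :=
  [set d : {set T} | d \in [seq [set x; next c x] | x <- c]].

Definition incidence (F : {set {set T}}) : edge_space :=
  [ffun d : edge => ((val d \in F)%:R)%R].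

(* The vertices of a cycle are distinct, so sequences of size at most #|T|
   account for all cycles. *)
Definition cycle_space : {vspace edge_space} :=
  <<[seq incidence (cycle_edges c)
      | c : #|T|.-bseq T in [pred c : #|T|.-bseq T | is_cycle c]]>>%VS.

Definition cycle_space_of_length (k : nat) : {vspace edge_space} :=
  <<[seq incidence (cycle_edges c)
      | c : #|T|.-bseq T
        in [pred c : #|T|.-bseq T | is_cycle c && (size c == k)]]>>%VS.

End SimpleGraph.

(* Main.v *)
Require Import Defs.
From mathcomp Require Import all_boot all_order all_algebra.
From mathcomp Require Import zify ring.

(** Let [d] be the minimum degree and [h = d - 11].  The bound on the balanced
    independence number says exactly that any [h] vertices of [X] and any [h]
    vertices of [Y] are joined by an edge (lemma [edge_between]).  The proof has
    two halves.

    Hamilton paths with prescribed ends.  Let [U] induce a balanced subgraph of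
    minimum degree at least [h + 2].  Then any two vertices of [U] of opposite
    colours are the ends of a path that spans [U] (lemma [laceable]).  A largest
    matching of [U] is perfect, since an unmatched pair could be augmented along
    an edge between the partners of its neighbours.  Now take a longest path [L]
    with the given ends whose complement in [U] is perfectly matchable, and,
    supposing that it does not span [U], a longest even path [Q] off [L], with
    ends [a] and [b], such that the vertices on neither path are still perfectly
    matchable.  The ends of [Q] have opposite colours, and all their neighbours
    lie on [L] or [Q], since any other one would prolong [Q] together with its
    partner.  Rotating [Q] yields many more choices of [b].  If [a] meets
    [L] at position [i] and [b] at position [j], the piece of [L] between them
    may be exchanged for [Q], so it has at least [size Q] vertices.  If moreover a
    vertex shortly after [i] is adjacent to the successor of a neighbour of [b],
    there is a crossing exchange that loses only the few vertices after [i].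
    Hence the set of vertices shortly after neighbours of [a], and the set of
    successors of neighbours of [b], span no edge.  Some position of [L] is far
    from all neighbours of [a], for otherwise rotated ends could not meet [L]; and
    as [Q] is long when [a] has few neighbours on [L], it follows that both sets
    have at least [d - 2] elements, a contradiction.  The argument needs a path
    [L] that is not too short.  A long cycle, cut from a longest even path with
    matchable complement, extends to a spanning cycle of [U] (lemma
    [spanning_cycle]), and the longer of the two arcs of that cycle between two
    given vertices is a suitable start for them.

    Generating the cycle space.  Suppose that two paths [p] and [p'] have the
    same ends and the same vertices, at most nine of each colour.  Deleting the
    interior of [p] lowers degrees by at most eight, so some path through all
    remaining vertices closes both [p] and [p'] to Hamilton cycles, and the sum
    of [p] and [p'] over F_2 is a sum of two Hamilton cycles (lemma
    [reroutings_congruent]).  An octagon is such a sum: link its vertices in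
    pairs by paths of four edges, as in a ladder, and let [p] use every other edge
    of the octagon and [p'] the remaining ones (lemma [octagon_mem]).  A hexagon
    is the sum of two octagons and a quadrangle the sum of two hexagons, through
    theta graphs.  Finally vertices of opposite colours are joined by a walk of
    three edges, which cuts a closed walk of length eight off any longer one; by
    induction every cycle is a sum of Hamilton cycles (lemma [closed_walk_mem]). *)

Set Implicit Arguments.
Unset Strict Implicit.
Unset Printing Implicit Defensive.

(** * Paths as lists, and their colours *)

Section Segments.
Variables (T : eqType) (e : rel T).

Definition seg (x y : T) (s : seq T) : bool :=
  if s is z :: t then [&& z == x, last z t == y & path e z t] else false.

Definition slice (i j : nat) (s : seq T) : seq T := take (j - i) (drop i s).

Lemma seg_sorted x y s : seg x y s -> sorted e s.
Proof. by case: s => // z s /and3P[]. Qed.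

Lemma seg_gt0 x y s : seg x y s -> 0 < size s.
Proof. by case: s. Qed.

Lemma seg_head x0 x y s : seg x y s -> nth x0 s 0 = x.
Proof. by case: s => // z s /and3P[/eqP]. Qed.

Lemma seg_last x0 x y s : seg x y s -> nth x0 s (size s).-1 = y.
Proof. by case: s => // z s /and3P[_ /eqP <- _] /=; rewrite -last_nth. Qed.

Lemma segE x0 s : sorted e s -> 0 < size s ->
  seg (nth x0 s 0) (nth x0 s (size s).-1) s.
Proof. by case: s => // z s /= -> _; rewrite eqxx -last_nth eqxx. Qed.

Lemma seg_cat x y x' y' s t :
  seg x y s -> seg x' y' t -> e y x' -> seg x y' (s ++ t).
Proof.
case: s t => // z s [|z' t] //= /and3P[-> /eqP ls ps] /and3P[/eqP-> lt pt] exy.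
by rewrite last_cat cat_path /= ls ps exy pt lt.
Qed.

Lemma seg_rev (e_sym : symmetric e) x y s : seg x y s -> seg y x (rev s).
Proof.
case: s => // z s /and3P[/eqP <- /eqP <- p].
rewrite /seg lastI rev_rcons eqxx /=.
have -> : last (last z s) (rev (belast z s)) = z.
  by case: s {p} => [|w s] //=; rewrite rev_cons last_rcons.
rewrite eqxx /=; have := rev_path e z s; rewrite (eq_path (e' := e)) => [->//|].
by move=> ? ?; apply: e_sym.
Qed.

Lemma sorted_take j s : sorted e s -> sorted e (take j s).
Proof. by case: s j => [|z s] [|j] //=; exact: take_path. Qed.

Lemma sorted_drop j s : sorted e s -> sorted e (drop j s).
Proof.
elim: s j => [|z s IH] [|j] //= p; apply: IH.
by case: s p => //= w s /andP[].
Qed.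

Lemma sorted_slice i j s : sorted e s -> sorted e (slice i j s).
Proof. by move=> ?; apply/sorted_take/sorted_drop. Qed.

Lemma size_slice i j s : j <= size s -> size (slice i j s) = j - i.
Proof. by move=> le; rewrite size_takel // size_drop; lia. Qed.

Lemma seg_slice x0 i j s : sorted e s -> i < j -> j <= size s ->
  seg (nth x0 s i) (nth x0 s j.-1) (slice i j s).
Proof.
move=> ss ij js; have sz := size_slice i js.
have := segE x0 (sorted_slice i j ss); rewrite sz subn_gt0 => /(_ ij).
by rewrite /slice !nth_take ?nth_drop ?addn0; [congr (seg _ (nth _ _ _) _)| |]; lia.
Qed.

Lemma slice_cat i j k s : i <= j -> j <= k ->
  slice i j s ++ slice j k s = slice i k s.
Proof.
move=> ij jk; rewrite /slice.
have -> : k - i = (j - i) + (k - j) by lia.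
by rewrite takeD drop_drop subnK.
Qed.

Lemma slice_full s : slice 0 (size s) s = s.
Proof. by rewrite /slice drop0 subn0 take_size. Qed.

Lemma slice3 i j s : i <= j -> j <= size s ->
  s = slice 0 i s ++ slice i j s ++ slice j (size s) s.
Proof. by move=> ij js; rewrite slice_cat // slice_cat ?slice_full //; lia. Qed.

Lemma slice4 i j k s : i <= j -> j <= k -> k <= size s ->
  s = slice 0 i s ++ slice i j s ++ slice j k s ++ slice k (size s) s.
Proof. by move=> ij jk ks; rewrite slice_cat // slice_cat ?slice_cat ?slice_full //; lia. Qed.

Variables (col : pred T).
Hypothesis e_col : forall x y, e x y -> col y = ~~ col x.

Lemma nth_col x0 s i : sorted e s -> i < size s ->
  col (nth x0 s i) = col (nth x0 s 0) (+) odd i.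
Proof.
case: s => // z s /= p; elim: i => [|i IH] lt; first by rewrite addbF.
have /(_ i lt) ee := pathP x0 p.
have {}IH := IH (ltnW lt).
by rewrite (e_col ee) /= IH -addbN.
Qed.

Lemma seg_col x y s : seg x y s -> ~~ odd (size s) -> col y = ~~ col x.
Proof.
move=> sg ev; have gt := seg_gt0 sg.
rewrite -(seg_last x sg) -{2}(seg_head x sg) (nth_col x (seg_sorted sg)); last lia.
by rewrite (_ : odd _ = true) ?addbT //; lia.
Qed.

Lemma seg_even x y s : seg x y s -> col y = ~~ col x -> ~~ odd (size s).
Proof.
move=> sg; have gt := seg_gt0 sg.
rewrite -(seg_last x sg) -{2}(seg_head x sg) (nth_col x (seg_sorted sg)); last by rewrite prednK.
by case: (size s) gt => //= n _; rewrite negbK; case: (col _); case: (odd n).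
Qed.

Lemma count_col c s : sorted e s -> ~~ odd (size s) ->
  count (fun z => col z == c) s = (size s)./2.
Proof.
have [n] := ubnP (size s); elim: n s => // n IH [|x [|y s]] //= lt.
move=> /andP[exy p]; rewrite negbK => ev.
rewrite IH //; last 2 first.
- lia.
- by case: s p {lt ev} => //= z s /andP[].
by rewrite (e_col exy); case: (col x); case: c {IH}; rewrite ?add0n ?addnA; lia.
Qed.

End Segments.

(** * Perfectly matchable sets *)

Lemma set_col (T : finType) (col : pred T) (A : {set T}) :
  ([set x in A | col x == true] = [set x in A | col x]) *
  ([set x in A | col x == false] = [set x in A | ~~ col x]).
Proof. by split; apply/setP => x; rewrite !inE ?eqb_id ?eqbF_neg. Qed.

Section Matchable.
Variables (T : finType) (e : rel T).
Hypothesis e_sym : symmetric e.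

(** The matching is given by an involution; its values off [R] are arbitrary. *)
Definition matchable (R : {set T}) : bool :=
  [exists f : {ffun T -> T},
    [forall x in R, [&& f x \in R, e x (f x) & f (f x) == x]]].

Lemma matchableP (R : {set T}) : reflect (exists f : T -> T,
   forall x, x \in R -> [/\ f x \in R, e x (f x) & f (f x) = x]) (matchable R).
Proof.
apply: (iffP existsP) => [[f /forallP fP]|[f fP]].
  by exists f => x xR; have := fP x; rewrite xR => /and3P[? ? /eqP].
exists [ffun x => f x]; apply/forallP => x; apply/implyP => /fP[fR ef ff].
by rewrite !ffunE fR ef ff eqxx.
Qed.

Lemma matchable0 : matchable set0.
Proof. by apply/matchableP; exists id => x; rewrite inE. Qed.

Lemma matchableU R S : matchable R -> matchable S -> [disjoint R & S] ->
  matchable (R :|: S).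
Proof.
move=> /matchableP[f fP] /matchableP[g gP] dis.
apply/matchableP; exists (fun x => if x \in R then f x else g x) => x.
rewrite inE; case: (boolP (x \in R)) => [xR _|xR /= xS].
  by have [fR ef ff] := fP _ xR; rewrite inE fR.
have [gS eg gg] := gP _ xS.
by rewrite inE gS orbT (disjointFl dis gS).
Qed.

Lemma matchable_pair R x y : matchable R -> e x y -> x != y -> x \notin R ->
  y \notin R -> matchable ([set x; y] :|: R).
Proof.
move=> mR exy xy xR yR; have yx : (y == x) = false by rewrite eq_sym (negPf xy).
apply: matchableU => //.
  apply/matchableP; exists (fun z => if z == x then y else x) => z.
  by rewrite !inE => /orP[] /eqP->; rewrite ?eqxx ?yx ?inE ?eqxx ?orbT // e_sym.
by rewrite -setI_eq0; apply/eqP/setP => z; rewrite !inE;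
  case: eqP => [->|_]; [rewrite (negPf xR)|case: eqP => [->|_]; rewrite ?(negPf yR)].
Qed.

Lemma matchable_path s : sorted e s -> uniq s -> ~~ odd (size s) ->
  matchable [set x in s].
Proof.
have [n] := ubnP (size s); elim: n s => // n IH [|x [|y s]] //= lt.
  by move=> _ _ _; rewrite (_ : [set _ in _] = set0) ?matchable0 //; apply/setP=> z; rewrite !inE.
move=> /andP[exy p]; rewrite negbK inE negb_or => /and3P[/andP[xy xs] ys us] ev.
have -> : [set z in x :: y :: s] = [set x; y] :|: [set z in s].
  by apply/setP => z; rewrite !inE orbA.
apply: matchable_pair; rewrite ?inE //; apply: IH => //; first lia.
by case: s p {lt ev us xs ys} => //= z s /andP[].
Qed.

Lemma matchableD (R S : {set T}) (f : T -> T) :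
  (forall x, x \in R -> [/\ f x \in R, e x (f x) & f (f x) = x]) ->
  {in S, forall x, f x \in S} -> matchable (R :\: S).
Proof.
move=> fP fS; apply/matchableP; exists f => y; rewrite !inE => /andP[yS yR].
have [fR ef ff] := fP _ yR; rewrite fR ef ff; split=> //; rewrite andbT.
by apply: contra yS => /fS; rewrite ff.
Qed.

Lemma matchableD2 (R : {set T}) (f : T -> T) x :
  (forall x, x \in R -> [/\ f x \in R, e x (f x) & f (f x) = x]) ->
  x \in R -> matchable (R :\: [set x; f x]).
Proof.
move=> fP xR; apply: (matchableD fP) => y; have [_ _ ffx] := fP _ xR.
by rewrite !inE => /orP[] /eqP->; rewrite ?ffx eqxx ?orbT.
Qed.

Lemma matchable_balanced (col : pred T) (R : {set T}) :
    (forall x y, e x y -> col y = ~~ col x) -> matchable R ->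
  #|[set x in R | col x]| = #|[set x in R | ~~ col x]|.
Proof.
move=> e_col /matchableP[f fP].
have le c : #|[set x in R | col x == c]| <= #|[set x in R | col x == ~~ c]|.
  rewrite -(card_in_imset (f := f)); last first.
    move=> x y; rewrite !inE => /andP[/fP[_ _ fx] _] /andP[/fP[_ _ fy] _] E.
    by rewrite -fx E fy.
  apply/subset_leq_card/subsetP => _ /imsetP[x + ->]; rewrite !inE => /andP[/fP[-> ef _] /eqP <-].
  by rewrite (e_col _ _ ef) eqxx.
have := le true; have := le false; rewrite /= !set_col => l1 l2.
by apply/eqP; rewrite eqn_leq l1 l2.
Qed.

End Matchable.

(** * Counting positions on a list *)

Lemma ex_max_uniq_seq (T : finType) (P : pred (seq T)) s0 :
    P s0 -> (forall s, P s -> uniq s) ->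
  exists s, P s /\ forall t, P t -> size t <= size s.
Proof.
move=> Ps0 Pu; pose p k := [exists t : k.-tuple T, P t].
have pP t : P t -> p (size t) by move=> Pt; apply/existsP; exists (in_tuple t).
have ub i : p i -> i <= #|T|.
  by case/existsP=> t /Pu /card_uniqP; rewrite size_tuple => <-; apply: max_card.
have [|i /existsP[t Pt] imax] := ex_maxnP (P := p) _ ub.
  by exists (size s0); apply: pP.
by exists t; split=> // t' /pP /imax; rewrite size_tuple.
Qed.

(** The set of positions reached from [I] by odd shifts below [2 r] exceeds [I] by
    nearly [r]: the shifts by one are injective, and the last element of [I]
    before the gap at [k0] contributes its [r - 1] longer shifts, none of which
    is a successor of an element of [I].  The position of [k0] guarantees that
    they stay in range. *)
Lemma count_shifts (I : pred nat) N r i0 k0 :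
    0 < r -> I i0 -> i0 < k0 -> k0 < N ->
    (forall i, i < k0 -> I i -> i + r.*2 < k0) ->
  count I (iota 0 N) + r <=
  (count (fun j => has (fun i => [&& I i, i < j, j <= i + r.*2 & odd (j - i)])
                       (iota 0 N)) (iota 0 N)).+2.
Proof.
move=> r0 Ii0 ik0 k0N far; set J := fun j => has _ _.
have [||i1 /andP[i1k Ii1] i1max] := @ex_maxnP (fun i => (i < k0) && I i) k0.
- by exists i0; rewrite ik0.
- by move=> i /andP[/ltnW].
pose s1 := [seq i.+1 | i <- iota 0 N.-1 & I i].
pose s2 := [seq i1 + t.*2.+1 | t <- iota 1 r.-1].
have i1far := far _ i1k Ii1.
have us : uniq (s1 ++ s2).
  rewrite cat_uniq !map_inj_uniq; last 2 first.
  - by move=> t t'; lia.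
  - exact: succn_inj.
  rewrite filter_uniq ?iota_uniq //= andbT; apply/hasPn => j /mapP[t].
  rewrite mem_iota => tr Ej; apply/mapP => -[i]; rewrite mem_filter => /andP[Ii _] Ej'.
  have := i1max i; rewrite Ii andbT; have -> : i < k0 by lia.
  by move=> /(_ isT); lia.
have sub : {subset s1 ++ s2 <= [seq j <- iota 0 N | J j]}.
  move=> j; rewrite mem_cat mem_filter mem_iota => /orP[] /mapP[i].
    rewrite mem_filter mem_iota => /andP[Ii iN] ->; apply/andP; split; last lia.
    by apply/hasP; exists i; rewrite ?mem_iota ?Ii /=; lia.
  rewrite mem_iota => iN ->; apply/andP; split; last lia.
  by apply/hasP; exists i1; rewrite ?mem_iota ?Ii1 /=; lia.
have := uniq_leq_size us sub; rewrite size_cat !size_map !size_filter size_iota.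
have -> : count I (iota 0 N) = count I (iota 0 N.-1) + I N.-1.
  have {1}-> : N = N.-1 + 1 by lia.
  by rewrite iotaD count_cat /= addn0.
rewrite -[count [eta I] _]/(count I _) -[count [eta J] _]/(count J _).
by have := leq_b1 (I N.-1); lia.
Qed.

Section Successors.
Variables (T : finType) (x0 : T).

Definition successors (P : pred T) (s : seq T) : seq T :=
  [seq nth x0 s i.+1 | i <- iota 0 (size s).-1 & P (nth x0 s i)].

Lemma mem_successors (P : pred T) (s : seq T) y : y \in successors P s ->
  exists i, [/\ i.+1 < size s, P (nth x0 s i) & y = nth x0 s i.+1].
Proof.
case/mapP=> i; rewrite mem_filter mem_iota => /andP[Pi lt] ->.
by exists i; split=> //; lia.
Qed.

Lemma successors_sub (P : pred T) (s : seq T) : {subset successors P s <= s}.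
Proof. by move=> y /mem_successors[i [lt _ ->]]; apply: mem_nth. Qed.

Lemma successors_uniq (P : pred T) (s : seq T) : uniq s -> uniq (successors P s).
Proof.
move=> us; rewrite map_inj_in_uniq ?filter_uniq ?iota_uniq //.
have lt k : k < (size s).-1 -> k.+1 < size s by lia.
move=> i j; rewrite !mem_filter !mem_iota => /andP[_ /lt lti] /andP[_ /lt ltj] /eqP.
by rewrite nth_uniq // => /eqP[].
Qed.

Lemma count_nth (P : pred T) (s : seq T) :
  count P s = count (fun i => P (nth x0 s i)) (iota 0 (size s)).
Proof. by rewrite -{1}(mkseq_nth x0 s) /mkseq count_map. Qed.

Lemma size_successors (P : pred T) (s : seq T) : count P s <= (size (successors P s)).+1.
Proof.
rewrite size_map size_filter count_nth; case: (size s) => [|k] //.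
rewrite -[in X in count _ X]addn1 iotaD count_cat [X in _ + X]/= addn0 -addn1 leq_add2l.
exact: leq_b1.
Qed.

End Successors.

Lemma perm_splice (T : eqType) (p q m s : seq T) :
  perm_eq ((p ++ q ++ s) ++ m) ((p ++ m ++ s) ++ q).
Proof. by apply/permP=> z; rewrite !count_cat; lia. Qed.

Lemma perm_splice_rev (T : eqType) (p q m r s : seq T) :
  perm_eq ((p ++ q ++ rev r ++ s) ++ m) ((p ++ m ++ r ++ s) ++ q).
Proof. by apply/permP=> z; rewrite !count_cat count_rev; lia. Qed.

Lemma perm_splice_rev2 (T : eqType) (p q m r s : seq T) :
  perm_eq ((p ++ rev q ++ rev r ++ s) ++ m) ((p ++ r ++ m ++ s) ++ q).
Proof. by apply/permP=> z; rewrite !count_cat !count_rev; lia. Qed.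

(** * Spanning paths with prescribed ends *)

Section Laceable.
Variables (T : finType) (e : rel T) (col : pred T) (U : {set T}) (h d : nat).
Hypothesis e_sym : symmetric e.
Hypothesis e_col : forall x y, e x y -> col y = ~~ col x.
Hypothesis no_hole : forall A B : {set T}, {in A, forall x, col x} ->
  {in B, forall x, ~~ col x} -> h <= #|A| -> h <= #|B| ->
  exists x y, [/\ x \in A, y \in B & e x y].
Hypothesis deg : forall x, x \in U -> d <= #|[set y in U | e x y]|.
Hypothesis hd : h + 2 <= d.
Hypothesis bal : #|[set x in U | col x]| = #|[set x in U | ~~ col x]|.

Lemma e_neq x y : e x y -> x != y.
Proof. by move=> exy; apply/eqP => E; have := e_col exy; rewrite E; case: (col y). Qed.

Lemma no_hole_seq c (s t : seq T) : uniq s -> uniq t -> {in s, forall x, col x = c} ->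
    {in t, forall x, col x = ~~ c} -> h <= size s -> h <= size t ->
  exists x y, [/\ x \in s, y \in t & e x y].
Proof.
have main (s' t' : seq T) : uniq s' -> uniq t' -> {in s', forall x, col x} ->
    {in t', forall x, ~~ col x} -> h <= size s' -> h <= size t' ->
    exists x y, [/\ x \in s', y \in t' & e x y].
  move=> us ut cs ct hs ht.
  have [||||x [y []]] := @no_hole [set x in s'] [set x in t'].
  - by move=> x; rewrite inE; apply: cs.
  - by move=> x; rewrite inE; apply: ct.
  - by rewrite cardsE (card_uniqP us).
  - by rewrite cardsE (card_uniqP ut).
  by rewrite !inE => xs yt exy; exists x, y.
move=> us ut cs ct hs ht; case: c cs ct => cs ct.
  by apply: main => // x xt; rewrite ct.
have [||x [y [xt ys exy]]] := main t s ut us _ _ ht hs.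
- by move=> x xt; rewrite ct.
- by move=> x xt; rewrite cs.
by exists y, x; rewrite e_sym.
Qed.

Lemma deg_count x (s : seq T) : x \in U -> uniq s ->
  (forall y, y \in U -> e x y -> y \in s) -> d <= count (e x) s.
Proof.
move=> xU us sub; apply: leq_trans (deg xU) _.
rewrite -size_filter -(card_uniqP (filter_uniq (e x) us)).
by apply/subset_leq_card/subsetP => y; rewrite inE mem_filter => /andP[yU exy]; rewrite exy sub.
Qed.

Lemma count_nbr x (s : seq T) : sorted e s -> ~~ odd (size s) -> count (e x) s <= (size s)./2.
Proof.
move=> ss ev; rewrite -(count_col e_col (~~ col x) ss ev); apply: sub_count => y /e_col ->.
by rewrite eqxx.
Qed.

(** [Q] is material that may be spliced into [L].  Both [Q] and the vertices of
    [U] on neither path are even and matchable, which keeps every exchange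
    balanced.  With [L] empty this is the condition imposed on the paths to be
    extended. *)
Definition spare (L Q : seq T) : bool :=
  [&& sorted e Q, uniq (L ++ Q), ~~ odd (size Q), all [in U] Q &
      matchable e (U :\: [set x in L ++ Q])].

Definition max_spare (L Q : seq T) : Prop :=
  spare L Q /\ forall Q', spare L Q' -> size Q' <= size Q.

Lemma spare_perm L Q Q' : spare L Q -> perm_eq Q' Q -> sorted e Q' -> spare L Q'.
Proof.
move=> /and5P[_ uQ ev aQ mQ] pQ sQ; rewrite /spare sQ (perm_size pQ) ev (perm_all _ pQ) aQ.
rewrite (perm_uniq (_ : perm_eq _ (L ++ Q))) ?perm_cat2l // uQ.
rewrite (_ : [set x in L ++ Q'] = [set x in L ++ Q]) //.
by apply/setP => x; rewrite !inE !mem_cat (perm_mem pQ).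
Qed.

Lemma spare_permL L L' Q : spare L Q -> perm_eq L' L -> spare L' Q.
Proof.
move=> /and5P[sQ uQ ev aQ mQ] pL; rewrite /spare sQ ev aQ.
rewrite (perm_uniq (_ : perm_eq _ (L ++ Q))) ?perm_cat2r // uQ.
rewrite (_ : [set x in L' ++ Q] = [set x in L ++ Q]) //.
by apply/setP => x; rewrite !inE !mem_cat (perm_mem pL).
Qed.

Lemma spare_seg_rev L Q a b : spare L Q -> seg e a b Q -> spare L (rev Q).
Proof.
move=> cQ sQ; apply: spare_perm cQ _ _; first by rewrite perm_rev.
exact: seg_sorted (seg_rev e_sym sQ).
Qed.

Lemma max_spare_perm L Q Q' : max_spare L Q -> spare L Q' -> size Q' = size Q -> max_spare L Q'.
Proof. by move=> [_ mx] cQ' E; split=> // Q'' /mx; rewrite E. Qed.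

Lemma max_spare_seg_rev L Q a b : max_spare L Q -> seg e a b Q -> max_spare L (rev Q).
Proof.
move=> mQ sQ; apply: (max_spare_perm mQ); rewrite ?size_rev //.
exact: spare_seg_rev mQ.1 sQ.
Qed.

(** A matched pair off [L] is itself such a path, so a longest one is not empty. *)
Lemma ex_max_spare L : uniq L -> matchable e (U :\: [set x in L]) ->
  (exists2 x, x \in U & x \notin L) -> exists Q, max_spare L Q /\ 0 < size Q.
Proof.
move=> uL mL [x xU xL].
have c0 : spare L [::] by rewrite /spare /= cats0 uL mL.
have [|Q [cQ mQ]] := @ex_max_uniq_seq _ (spare L) _ c0.
  by move=> s /and5P[_ +]; rewrite cat_uniq => /and3P[].
exists Q; split=> //; have /matchableP[f fP] := mL.
have xR : x \in U :\: [set x in L] by rewrite !inE xL xU.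
have [fR ef ff] := fP _ xR.
suff c2 : spare L [:: x; f x] by apply: leq_trans (mQ _ c2).
move: (fR); rewrite !inE => /andP[fL fU].
rewrite /spare /= ef cat_uniq uL /= !inE (e_neq ef) xU fU (negPf xL) (negPf fL) /=.
rewrite (_ : _ :\: _ = (U :\: [set x in L]) :\: [set x; f x]) ?matchableD2 //.
apply/setP => y; rewrite !inE mem_cat !inE !negb_or.
by case: (y == x); case: (y == f x); rewrite ?andbF ?andbT.
Qed.

(** Otherwise the neighbour together with its partner in the remaining matching
    would prolong [Q]. *)
Lemma max_spare_absorb L Q a b y : max_spare L Q -> seg e a b Q -> y \in U ->
  e a y -> y \in L ++ Q.
Proof.
move=> [/and5P[sQ uQ ev aQ mQ] mx] sg yU eay; apply/negPn/negP => yLQ.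
have /matchableP[f fP] := mQ.
have yR : y \in U :\: [set x in L ++ Q] by rewrite !inE yLQ yU.
have [fR ef ff] := fP _ yR; move: (fR); rewrite !inE => /andP[fLQ fU].
suff /mx : spare L [:: f y, y & Q] by rewrite /= ltnNge leqnSn.
have ps : perm_eq (L ++ [:: f y, y & Q]) ([:: f y, y & L ++ Q]).
  exact: (permEl (perm_catCA L [:: f y; y] Q)).
rewrite /spare (perm_uniq ps) /= e_sym ef negbK ev yU fU aQ uQ yLQ !inE negb_or.
rewrite eq_sym (e_neq ef) fLQ /=; apply/andP; split.
  by case: Q sg sQ {mx uQ ev aQ mQ yLQ yR fP fR fLQ ps} => //= z Q /and3P[/eqP-> _ _] ->; rewrite e_sym eay.
rewrite (_ : _ :\: _ = (U :\: [set x in L ++ Q]) :\: [set y; f y]) ?matchableD2 //.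
apply/setP => z; rewrite !inE (perm_mem ps) !inE !negb_or.
by case: (z == y); case: (z == f y); rewrite ?andbF.
Qed.

(** Rotation: the successor on [Q] of a neighbour of the last vertex can be made
    the last vertex, without changing the first one or the vertex set. *)
Lemma spare_rotate L Q a b x0 j : spare L Q -> seg e a b Q -> j.+1 < size Q ->
  e b (nth x0 Q j) ->
  exists Q' : seq T, [/\ seg e a (nth x0 Q j.+1) Q', perm_eq Q' Q & spare L Q'].
Proof.
move=> cQ sg lt ebj; have sQ := seg_sorted sg.
pose Q' := slice 0 j.+1 Q ++ rev (slice j.+1 (size Q) Q).
have pQ : perm_eq Q' Q.
  have EQ : Q = slice 0 j.+1 Q ++ slice j.+1 (size Q) Q.
    by rewrite slice_cat ?slice_full // ltnW.
  by rewrite [X in perm_eq _ X]EQ perm_cat2l perm_rev.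
have sg' : seg e a (nth x0 Q j.+1) Q'.
  rewrite -(seg_head x0 sg); apply: seg_cat (seg_slice x0 sQ _ _) _ _ => //; first exact: ltnW.
    exact: (seg_rev e_sym (seg_slice x0 sQ lt (leqnn _))).
  by rewrite /= (seg_last x0 sg) e_sym.
by exists Q'; split=> //; apply: spare_perm cQ pQ (seg_sorted sg').
Qed.

Definition maxpath (u v : T) (L : seq T) : Prop :=
  [/\ seg e u v L, spare [::] L &
      forall L' : seq T, seg e u v L' -> spare [::] L' -> size L' <= size L].

Lemma maxpath_rev u v (L : seq T) : maxpath u v L -> maxpath v u (rev L).
Proof.
move=> [sL cL mx]; split; first exact: (seg_rev e_sym).
  exact: (spare_seg_rev cL sL).
move=> L' sL' cL'; rewrite size_rev -(size_rev L'); apply: mx.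
  exact: (seg_rev e_sym).
exact: (spare_seg_rev cL' sL').
Qed.

(** The common part of all exchanges: if the pieces of [L] and [Q] are reassembled
    into a path with the same ends that omits only [mid], then the vertices off
    the new path are still matchable, because [mid] is an even path.  As [L] is
    longest, [mid] is at least as long as [Q]. *)
Lemma reroute_loses_enough u v (L Q L' mid : seq T) : maxpath u v L -> spare L Q -> seg e u v L' ->
    perm_eq (L' ++ mid) (L ++ Q) -> sorted e mid -> ~~ odd (size mid) ->
  size Q <= size mid.
Proof.
move=> [sL cL mx] cQ sL' p smid emid.
have /and5P[_ _ eL aL _] := cL; have /and5P[sQ uQ eQ aQ mQ] := cQ.
have sz : size L' + size mid = size L + size Q by rewrite -!size_cat (perm_size p).
have uLm : uniq (L' ++ mid) by rewrite (perm_uniq p).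
have aLm : all [in U] (L' ++ mid) by rewrite (perm_all _ p) all_cat aL.
suff cL' : spare [::] L' by have := mx _ sL' cL'; move: sz; clear; lia.
move: (uLm) (aLm); rewrite cat_uniq all_cat => /and3P[uL' dis um] /andP[aL' am].
rewrite /spare (seg_sorted sL') uL' aL' /=; apply/andP; split; first by move: eL eQ emid sz; clear; lia.
have -> : U :\: [set x in L'] = (U :\: [set x in L ++ Q]) :|: [set x in mid].
  apply/setP => x; rewrite !inE -(perm_mem p) mem_cat.
  case xm: (x \in mid); last by rewrite !orbF.
  rewrite orbT /= (allP am) // andbT; apply/negP => xL'.
  by case/hasP: dis; exists x.
apply: matchableU => //; first exact: matchable_path.
rewrite -setI_eq0; apply/eqP/setP => x; rewrite !inE -(perm_mem p) mem_cat.
by case: (x \in mid); rewrite ?orbT ?andbF.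
Qed.

(** [Q] replaces the piece of [L] between the two contacts. *)
Lemma contacts_far_apart_lt x0 u v (L Q : seq T) a b i j :
    maxpath u v L -> spare L Q -> seg e a b Q ->
  i < j -> j < size L -> e a (nth x0 L i) -> e b (nth x0 L j) -> size Q + i < j.
Proof.
move=> mL cQ sQ ij jN eai ebj; have [sL _ _] := mL; have ss := seg_sorted sL.
have /and5P[_ _ eQ _ _] := cQ.
have odd_ji : odd (j - i).
  have := nth_col e_col x0 ss jN; have := nth_col e_col x0 ss (ltn_trans ij jN).
  rewrite (e_col eai) (e_col ebj) (seg_col e_col sQ eQ) negbK oddB ?(ltnW ij) //.
  by case: (col a); case: (col _); case: (odd i); case: (odd j).
have EL := slice3 ij (ltnW jN).
have sz : size (slice i.+1 j L) = j - i.+1 by rewrite size_slice // ltnW.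
suff : size Q <= size (slice i.+1 j L) by rewrite sz; lia.
apply: (@reroute_loses_enough u v L Q (slice 0 i.+1 L ++ Q ++ slice j (size L) L)) => //.
- rewrite -(seg_head x0 sL) -(seg_last x0 sL).
  apply: seg_cat (seg_slice x0 ss _ _) _ _ => //; first exact: ltn_trans jN.
    by apply: seg_cat sQ (seg_slice x0 ss _ _) _.
  by rewrite e_sym.
- by rewrite [X in perm_eq _ (X ++ _)]EL perm_splice.
- exact: sorted_slice.
- by rewrite sz; lia.
Qed.

Lemma contacts_far_apart x0 u v (L Q : seq T) a b i j : maxpath u v L -> spare L Q ->
    seg e a b Q -> i < size L -> j < size L ->
    e a (nth x0 L i) -> e b (nth x0 L j) ->
  size Q + i < j \/ size Q + j < i.
Proof.
move=> mL cQ sQ iN jN eai ebj; have /and5P[_ _ eQ _ _] := cQ.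
case: (ltngtP i j) => [ij|ji|E]; first by left; exact: (contacts_far_apart_lt (x0 := x0) mL cQ sQ).
  right; rewrite -size_rev.
  exact: (contacts_far_apart_lt (x0 := x0) mL (spare_seg_rev cQ sQ) (seg_rev e_sym sQ)).
have := e_col ebj; rewrite -E (e_col eai) (seg_col e_col sQ eQ).
by case: (col a).
Qed.

(** The new path leaves [L] at the contact [i] of [a], runs through [Q] to the
    contact [k] of [b], returns along [L] from [k] to [j] and jumps to [k + 1];
    it omits the vertices strictly between [i] and [j]. *)
Lemma cross_after x0 u v (L Q : seq T) a b i j k : maxpath u v L -> spare L Q ->
    seg e a b Q -> i < j -> odd (j - i) -> j <= k -> k.+1 < size L ->
    e a (nth x0 L i) -> e b (nth x0 L k) -> e (nth x0 L j) (nth x0 L k.+1) ->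
  size Q + i < j.
Proof.
move=> mL cQ sQ ij odd_ji jk kN eai ebk ejk; have [sL _ _] := mL; have ss := seg_sorted sL.
have EL := slice4 ij (leqW jk) (ltnW kN).
have sz : size (slice i.+1 j L) = j - i.+1 by rewrite size_slice // (leq_trans jk) // ltnW // ltnW.
have iN : i < size L by lia.
suff : size Q <= size (slice i.+1 j L) by rewrite sz; lia.
apply: (@reroute_loses_enough u v L Q
  (slice 0 i.+1 L ++ Q ++ rev (slice j k.+1 L) ++ slice k.+1 (size L) L)) => //.
- rewrite -(seg_head x0 sL) -(seg_last x0 sL).
  have s1 : seg e (nth x0 L 0) (nth x0 L i) (slice 0 i.+1 L) by apply: seg_slice.
  have s2 : seg e (nth x0 L j) (nth x0 L k) (slice j k.+1 L).
    by apply: (seg_slice x0 ss) => //; apply: ltnW.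
  have s3 : seg e (nth x0 L k.+1) (nth x0 L (size L).-1) (slice k.+1 (size L) L).
    exact: seg_slice.
  apply: seg_cat s1 (seg_cat sQ (seg_cat (seg_rev e_sym s2) s3 ejk) ebk) _.
  by rewrite e_sym.
- by rewrite [X in perm_eq _ (X ++ _)]EL perm_splice_rev.
- exact: sorted_slice.
- by rewrite sz; lia.
Qed.

(** The new path leaves [L] at the contact [k] of [b], runs back through [Q] to
    the contact [i] of [a], returns along [L] from [i] to [k + 1] and jumps to [j];
    it omits the vertices strictly between [i] and [j]. *)
Lemma cross_before x0 u v (L Q : seq T) a b i j k : maxpath u v L -> spare L Q ->
    seg e a b Q -> i < j -> odd (j - i) -> k < i -> j < size L ->
    e a (nth x0 L i) -> e b (nth x0 L k) -> e (nth x0 L j) (nth x0 L k.+1) ->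
  size Q + i < j.
Proof.
move=> mL cQ sQ ij odd_ji ki jN eai ebk ejk; have [sL _ _] := mL; have ss := seg_sorted sL.
have EL := slice4 (ltnW ki : k.+1 <= i.+1) ij (ltnW jN).
have sz : size (slice i.+1 j L) = j - i.+1 by rewrite size_slice // ltnW.
have iN : k < size L by lia.
suff : size Q <= size (slice i.+1 j L) by rewrite sz; lia.
apply: (@reroute_loses_enough u v L Q
  (slice 0 k.+1 L ++ rev Q ++ rev (slice k.+1 i.+1 L) ++ slice j (size L) L)) => //.
- rewrite -(seg_head x0 sL) -(seg_last x0 sL).
  have s1 : seg e (nth x0 L 0) (nth x0 L k) (slice 0 k.+1 L) by apply: seg_slice.
  have s2 : seg e (nth x0 L k.+1) (nth x0 L i) (slice k.+1 i.+1 L).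
    by apply: (seg_slice x0 ss) => //; apply: leq_trans ij (ltnW jN).
  have s3 : seg e (nth x0 L j) (nth x0 L (size L).-1) (slice j (size L) L).
    exact: seg_slice.
  rewrite e_sym in ejk; rewrite e_sym in ebk.
  apply: seg_cat s1 (seg_cat (seg_rev e_sym sQ) (seg_cat (seg_rev e_sym s2) s3 ejk) eai) ebk.
- by rewrite [X in perm_eq _ (X ++ _)]EL perm_splice_rev2.
- exact: sorted_slice.
- by rewrite sz; lia.
Qed.

Lemma spare_end_col (L Q : seq T) a b : spare L Q -> seg e a b Q -> col b = ~~ col a.
Proof. by move=> /and5P[_ _ eQ _ _] sQ; exact: (seg_col e_col sQ eQ). Qed.

Lemma spare_end_in (L Q : seq T) a b : spare L Q -> seg e a b Q -> a \in U.
Proof.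
move=> /and5P[_ _ _ /allP aQ _] sQ; apply: aQ.
by rewrite -(seg_head a sQ); apply: mem_nth (seg_gt0 sQ).
Qed.

Lemma end_degree (L Q : seq T) a b : max_spare L Q -> seg e a b Q ->
  d <= count (e a) L + count (e a) Q.
Proof.
move=> mQ sQ; have [cQ _] := mQ; have /and5P[_ uQ _ _ _] := cQ.
rewrite -count_cat; apply: (deg_count) => //; first exact: (spare_end_in cQ sQ).
by move=> y; apply: (max_spare_absorb mQ sQ).
Qed.

Lemma end_degree_last (L Q : seq T) a b : max_spare L Q -> seg e a b Q ->
  d <= count (e b) L + count (e b) Q.
Proof.
move=> mQ sQ; rewrite -(count_rev _ Q).
exact: end_degree (max_spare_seg_rev mQ sQ) (seg_rev e_sym sQ).
Qed.

(** The heart of the extension argument.  The vertices at an odd distance less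
    than [size Q] after a contact of [a], and the successors, on [Q] and on [L], of
    the neighbours of [b], are two sets of opposite colours with at least [d - 2]
    elements each.  Hence they span an edge, and each position of
    that edge leads to an exchange that omits fewer than [size Q] vertices.  The
    gap at [k0] is what makes the first set large. *)
Lemma no_contact_before_gap x0 u v (L Q : seq T) a b i0 k0 : maxpath u v L -> max_spare L Q ->
    seg e a b Q -> i0 < k0 -> k0 < size L -> e a (nth x0 L i0) ->
    (forall i, i < k0 -> e a (nth x0 L i) -> i + size Q < k0) ->
  False.
Proof.
move=> mL mQ sQ ik0 k0N ea0 far; have [cQ _] := mQ; have [sL cL _] := mL.
have /and5P[ssQ uLQ eQ _ _] := cQ; have ss := seg_sorted sL.
move: (uLQ); rewrite cat_uniq => /and3P[uL /hasPn dis uQ].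
pose r := (size Q)./2; have Er : size Q = r.*2 by rewrite even_halfK.
have r0 : 0 < r by rewrite -double_gt0 -Er (seg_gt0 sQ).
pose I i := e a (nth x0 L i).
pose J j := has (fun i => [&& I i, i < j, j <= i + r.*2 & odd (j - i)]) (iota 0 (size L)).
(* [A] collects the shifted contacts of [a], and [B] the successors for [b]. *)
pose A := [seq nth x0 L j | j <- iota 0 (size L) & J j].
pose B := successors x0 (e b) Q ++ successors x0 (e b) L.
have JP j : J j -> exists i, [/\ e a (nth x0 L i), i < j, j < i + size Q & odd (j - i)].
  case/hasP=> i _ /and4P[Ii ij ji odd_ji]; exists i; split=> //.
  by move: ij ji odd_ji; rewrite Er; clear; lia.
have AP y : y \in A -> exists j i, [/\ j < size L, y = nth x0 L j, e a (nth x0 L i), i < j &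
    j < i + size Q /\ odd (j - i)].
  case/mapP=> j; rewrite mem_filter mem_iota => /andP[/JP[i [? ? ? ?]] jN] ->.
  by exists j, i; split.
have sA : h <= size A.
  have far' i : i < k0 -> I i -> i + r.*2 < k0 by rewrite -Er; apply: far.
  have := count_shifts r0 ea0 ik0 k0N far'; rewrite -/J -(count_nth x0 (e a) L).
  have := end_degree mQ sQ; have := count_nbr a ssQ eQ; rewrite -/r.
  by rewrite size_map size_filter -[count [eta J] _]/(count J _); move: hd; clear; lia.
have colba := spare_end_col cQ sQ.
have sB : h <= size B.
  have := end_degree_last mQ sQ.
  have := size_successors x0 (e b) Q; have := size_successors x0 (e b) L.
  rewrite size_cat; by move: hd; clear; lia.
have uA : uniq A.
  rewrite map_inj_in_uniq ?filter_uniq ?iota_uniq //.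
  move=> i j; rewrite !mem_filter !mem_iota => /andP[_ iN] /andP[_ jN] /eqP.
  by rewrite nth_uniq // => /eqP.
have uB : uniq B.
  rewrite cat_uniq !successors_uniq //= andbT; apply/hasPn => y /successors_sub yL.
  by apply/negP => /successors_sub yQ; have := dis _ yQ; rewrite yL.
have cA : {in A, forall y, col y = col a}.
  move=> y /AP[j [i [jN -> eai ij [_ odd_ji]]]]; have := e_col eai.
  rewrite (nth_col e_col x0 ss jN) (nth_col e_col x0 ss (ltn_trans ij jN)).
  move: odd_ji; rewrite oddB ?(ltnW ij) //.
  by case: (col a); case: (col _); case: (odd i); case: (odd j).
have sucC (s : seq T) : sorted e s -> {in successors x0 (e b) s, forall y, col y = ~~ col a}.
  move=> sst y /mem_successors[k [kN ebk ->]]; have := e_col ebk.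
  by rewrite (nth_col e_col x0 sst kN) (nth_col e_col x0 sst (ltnW kN)) /= addbN => ->; rewrite ?colba ?negbK.
have cB : {in B, forall y, col y = ~~ col a}.
  by move=> y; rewrite mem_cat => /orP[]; apply: sucC.
(* The edge found below contradicts the maximality of [L] in every case. *)
have [y [z [/AP[j [i [jN -> eai ij [jiQ odd_ji]]]] zB exz]]] :=
  no_hole_seq uA uB cA cB sA sB.
move: zB; rewrite mem_cat => /orP[] /mem_successors[k [kN ebk Ez]].
  have [Q' [sQ' pQ' cQ']] := spare_rotate cQ sQ kN ebk.
  rewrite e_sym Ez in exz.
  have := contacts_far_apart mL cQ' sQ' (ltn_trans ij jN) jN eai exz.
  have EQ' : size Q' = size Q := perm_size pQ'.
  by move: EQ' ij jiQ; clear; lia.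
rewrite Ez in exz.
have iN := ltn_trans ij jN; have kN' := ltnW kN.
have ki : k <> i.
  move=> E; have := e_col ebk; rewrite E (e_col eai) colba.
  by case: (col a).
have [jk|kj] := leqP j k.
  have := cross_after mL cQ sQ ij odd_ji jk kN eai ebk exz.
  by move: jiQ; clear; lia.
have [ki'|ik] := ltnP k i.
  have := cross_before mL cQ sQ ij odd_ji ki' jN eai ebk exz.
  by move: jiQ; clear; lia.
have := contacts_far_apart mL cQ sQ iN kN' eai ebk.
by move: ki ik kj jiQ; clear; lia.
Qed.

(** If [b] has [d] neighbours on [Q], the ends obtained from it by rotation are
    numerous enough for one of them to be adjacent to [L]. *)
Lemma rotate_reach x0 (L Q : seq T) a b : max_spare L Q -> seg e a b Q ->
    sorted e L -> ~~ odd (size L) -> d <= count (e b) Q -> h <= (size L)./2 ->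
  exists (Q' : seq T) b' k, [/\ seg e a b' Q', perm_eq Q' Q, spare L Q', k < size L &
                      e b' (nth x0 L k)].
Proof.
move=> [cQ _] sQ ss eL dQ hL; have /and5P[ssQ uLQ eQ _ _] := cQ.
move: (uLQ); rewrite cat_uniq => /and3P[uL _ uQ].
have sB : h <= size (successors x0 (e b) Q).
  by have := size_successors x0 (e b) Q; move: hd dQ; clear; lia.
have sA : h <= size [seq y <- L | col y == col a] by rewrite size_filter (count_col e_col).
have cB : {in successors x0 (e b) Q, forall y, col y = ~~ col a}.
  move=> y /mem_successors[k [kN ebk ->]]; have := e_col ebk.
  rewrite (nth_col e_col x0 ssQ kN) (nth_col e_col x0 ssQ (ltnW kN)) /= addbN => ->.
  by rewrite (spare_end_col cQ sQ) negbK.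
have cA : {in [seq y <- L | col y == col a], forall y, col y = col a}.
  by move=> y; rewrite mem_filter => /andP[/eqP].
have [y [z [yA /mem_successors[j [jN ebj ->]] eyz]]] :=
  no_hole_seq (filter_uniq _ uL) (successors_uniq x0 (e b) uQ) cA cB sA sB.
have [Q' [sQ' pQ' cQ']] := spare_rotate cQ sQ jN ebj.
move: yA; rewrite mem_filter => /andP[_ /(nthP x0)[k kN Ek]].
by exists Q', (nth x0 Q j.+1), k; split; rewrite // Ek e_sym.
Qed.

Lemma spare_size (L Q : seq T) : all [in U] L -> spare L Q -> size L + size Q <= #|U|.
Proof.
move=> /allP aL /and5P[_ uLQ _ /allP aQ _]; rewrite -size_cat -(card_uniqP uLQ).
by apply/subset_leq_card/subsetP => x; rewrite mem_cat => /orP[/aL|/aQ].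
Qed.

(** It suffices to find a position [k0] of [L] far from all contacts of [a], on
    whichever side, since [L] may be reversed.  A contact of [b] is such a
    position.  If there is none, all neighbours of [b] are on [Q], and a position
    reached from a rotated end will do. *)
Lemma ends_avoid_maxpath x0 u v (L Q : seq T) a b i0 : maxpath u v L ->
    h <= (size L)./2 \/ #|U| < size L + d.*2 -> max_spare L Q -> seg e a b Q ->
    i0 < size L -> e a (nth x0 L i0) ->
  False.
Proof.
move=> mL big mQ sQ i0N ea0; have [cQ _] := mQ; have [sL cL _] := mL.
have /and5P[ssQ uLQ eQ _ _] := cQ; have ss := seg_sorted sL.
have /and5P[_ _ eL aL _] := cL.
pose F k := all (fun i => e a (nth x0 L i) ==> (size Q + i < k) || (size Q + k < i)) (iota 0 (size L)).
have FP k i : F k -> i < size L -> e a (nth x0 L i) -> size Q + i < k \/ size Q + k < i.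
  by move=> /allP/(_ i) + iN eai; rewrite mem_iota iN eai => /(_ isT)/orP.
have [k0 k0N Fk0] : exists2 k0, k0 < size L & F k0.
  have [/hasP[y /(nthP x0)[k kN <-] ebk]|nb] := boolP (has (e b) L).
    exists k => //; apply/allP => i; rewrite mem_iota => /andP[_ iN]; apply/implyP => eai.
    by apply/orP; apply: (contacts_far_apart (x0 := x0) mL cQ sQ).
  have bQ : d <= count (e b) Q.
    have := end_degree_last mQ sQ.
    by rewrite has_count -leqNgt leqn0 in nb; rewrite (eqP nb).
  have hL : h <= (size L)./2.
    have := spare_size aL cQ; have := count_nbr b ssQ eQ.
    by case: big => //; move: bQ; clear; lia.
  have [Q' [b' [k [sQ' pQ' cQ' kN ebk]]]] := rotate_reach x0 mQ sQ ss eL bQ hL.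
  exists k => //; apply/allP => i; rewrite mem_iota => /andP[_ iN]; apply/implyP => eai.
  by apply/orP; rewrite -(perm_size pQ'); apply: (contacts_far_apart (x0 := x0) mL cQ' sQ').
(* A contact before [k0] is used on [L] itself, one after [k0] on [rev L]. *)
case: (FP _ _ Fk0 i0N ea0) => [ik|ki].
  apply: (no_contact_before_gap (x0 := x0) mL mQ sQ _ k0N ea0); first by move: ik; clear; lia.
  move=> i ik0 eai; case: (FP _ _ Fk0 (ltn_trans ik0 k0N) eai); last by move: ik0; clear; lia.
  by rewrite addnC.
have prL : perm_eq (rev L) L by rewrite perm_rev.
have mQr : max_spare (rev L) Q.
  split; first exact: (spare_permL cQ).
  move=> Q' cQ'; apply: mQ.2; apply: (spare_permL cQ'); by rewrite perm_sym.
have sub i : i < size L -> size L - (size L - i.+1).+1 = i by move=> ?; rewrite subnSK // subKn // ltnW.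
apply: (no_contact_before_gap (x0 := x0) (i0 := size L - i0.+1) (k0 := size L - k0.+1) (maxpath_rev mL) mQr sQ).
- by move: ki i0N; clear; lia.
- by rewrite size_rev; move: k0N; clear; lia.
- by rewrite nth_rev ?sub //; move: i0N; clear; lia.
- move=> i ik; have iN : i < size L by move: ik; clear; lia.
  rewrite nth_rev // => eai.
  have iN' : size L - i.+1 < size L by move: iN; clear; lia.
  by case: (FP _ _ Fk0 iN' eai); move: ik k0N; clear; lia.
Qed.

(** If neither end of [Q] had a neighbour on [L], both would have all [d]
    neighbours on [Q], and rotation would produce an end that has one.  The size
    condition excludes the case of a path [L] too short for this. *)
Lemma maxpath_full u v (L : seq T) : maxpath u v L ->
  h <= (size L)./2 \/ #|U| < size L + d.*2 -> {subset U <= L}.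
Proof.
move=> mL big x xU; apply/negPn/negP => xL; have [sL cL _] := mL.
have /and5P[_ uL eL aL mtL] := cL; have ss := seg_sorted sL.
have [Q [mQ Q0]] := ex_max_spare uL mtL (ex_intro2 _ _ x xU xL).
have [cQ _] := mQ; have /and5P[ssQ _ eQ _ _] := cQ.
have sQ := segE x ssQ Q0; move: sQ; set a := nth x Q 0; set b := nth x Q _ => sQ.
have sQr := seg_rev e_sym sQ; have mQr := max_spare_seg_rev mQ sQ.
have [/hasP[y /(nthP x)[k kN <-] ebk]|nb] := boolP (has (e b) L).
  exact: (ends_avoid_maxpath mL big mQr sQr kN ebk).
have bQ : d <= count (e b) Q.
  have := end_degree_last mQ sQ.
  by rewrite has_count -leqNgt leqn0 in nb; rewrite (eqP nb).
have hL : h <= (size L)./2.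
  have := spare_size aL cQ; have := count_nbr b ssQ eQ.
  by case: big => //; move: bQ; clear; lia.
have [Q' [b' [k [sQ' pQ' cQ' kN ebk]]]] := rotate_reach x mQ sQ ss eL bQ hL.
have mQ' := max_spare_perm mQ cQ' (perm_size pQ').
exact: (ends_avoid_maxpath mL big (max_spare_seg_rev mQ' sQ') (seg_rev e_sym sQ') kN ebk).
Qed.

Lemma unmatched_opposite (R : {set T}) x : matchable e R -> R \subset U ->
  x \in U -> x \notin R -> exists y, [/\ y \in U, y \notin R & col y = ~~ col x].
Proof.
move=> mR /subsetP RU xU xR.
have [/existsP[y /and3P[yU yR /eqP cy]]|] :=
  boolP [exists y, [&& y \in U, y \notin R & col y == ~~ col x]]; first by exists y.
rewrite negb_exists => /forallP no; exfalso.
have no' y : y \in U -> col y = ~~ col x -> y \in R.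
  by move=> yU cy; apply/negPn/negP => yR; have := no y; rewrite yU yR cy eqxx.
have card_le : #|[set y in U | col y == ~~ col x]| <= #|[set y in R | col y == ~~ col x]|.
  apply/subset_leq_card/subsetP => y; rewrite !inE => /andP[yU /eqP cy].
  by rewrite no' // cy eqxx.
have card_lt : #|[set y in R | col y == col x]| < #|[set y in U | col y == col x]|.
  apply/proper_card/properP; split.
    by apply/subsetP => y; rewrite !inE => /andP[/RU->].
  by exists x; rewrite !inE eqxx ?xU // (negPf xR).
have := matchable_balanced e_col mR.
move: card_le card_lt; case: (col x); rewrite /= !set_col bal => le lt EQ.
  by rewrite EQ in lt; have := leq_trans lt le; rewrite ltnn.
by rewrite EQ in le; have := leq_trans lt le; rewrite ltnn.
Qed.

(** For an unmatched pair [x], [y] of opposite colours all neighbours are matched,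
    and the partners of the neighbours of [x] and of [y] are two sets of opposite
    colours with at least [h] elements.  An edge between them completes an
    augmenting path. *)
Lemma matchable_full : matchable e U.
Proof.
have [R /andP[mR RU] maxR] :=
  @arg_maxnP _ set0 (fun R : {set T} => matchable e R && (R \subset U)) (fun R => #|R|)
    (introT andP (conj (matchable0 e) (sub0set U))).
have [UR|/subsetPn[x xU xR]] := boolP (U \subset R).
  by rewrite (_ : U = R) //; apply/eqP; rewrite eqEsubset UR RU.
exfalso; have [y [yU yR cy]] := unmatched_opposite mR RU xU xR.
have bigger (R' : {set T}) : matchable e R' -> R' \subset U -> R \subset R' -> R' \subset R.
  move=> mR' R'U RR'; have /maxR le : matchable e R' && (R' \subset U) by rewrite mR'.
  by have := eqEcard R R'; rewrite RR' [X in _ && X]le => /eqP->.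
have sat z : z \in U -> z \notin R -> forall w, w \in U -> e z w -> w \in R.
  move=> zU zR w wU ezw; apply/negPn/negP => wR.
  have m' := matchable_pair e_sym mR ezw (e_neq ezw) zR wR.
  have m'U : [set z; w] :|: R \subset U by rewrite !subUset !sub1set zU wU.
  have /subsetP/(_ z) := bigger _ m' m'U (subsetUr _ _).
  by rewrite !inE eqxx /= (negPf zR) => /(_ isT).
have /matchableP[f fP] := mR.
pose nb z := enum [set f p | p in [set p in U | e z p]].
have nbP z w : w \in nb z -> exists p, [/\ p \in U, e z p & w = f p].
  by rewrite mem_enum => /imsetP[p]; rewrite inE => /andP[? ?] ->; exists p.
have nb_size z : z \in U -> z \notin R -> h <= size (nb z).
  move=> zU zR; rewrite -cardE card_in_imset.
    by apply: leq_trans (deg zU); move: hd; clear; lia.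
  move=> p q; rewrite !inE => /andP[pU /(sat _ zU zR _ pU)/fP[_ _ fp]].
  by move=> /andP[qU /(sat _ zU zR _ qU)/fP[_ _ fq]] E; rewrite -fp E fq.
have nb_col z : z \in U -> z \notin R -> {in nb z, forall w, col w = col z}.
  move=> zU zR w /nbP[p [pU ezp ->]]; have [_ efp _] := fP _ (sat _ zU zR _ pU ezp).
  by rewrite (e_col efp) (e_col ezp) negbK.
have cyn : {in nb y, forall w, col w = ~~ col x} by move=> w /(nb_col _ yU yR) ->.
have [_ [_ [/nbP[p [pU exp ->]] /nbP[q [qU eyq ->]] epq]]] :=
  no_hole_seq (enum_uniq _) (enum_uniq _) (nb_col _ xU xR) cyn
    (nb_size _ xU xR) (nb_size _ yU yR).
have pR := sat _ xU xR _ pU exp; have qR := sat _ yU yR _ qU eyq.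
have [fpR ep fp] := fP _ pR; have [fqR eq fq] := fP _ qR.
have neqR z w : z \in R -> w \notin R -> (z == w) = false.
  by move=> zR wR; apply: contraNF wR => /eqP <-.
pose S := [set p; f p; q; f q].
have mD : matchable e (R :\: S).
  apply: (matchableD fP) => z; rewrite !inE.
  by move=> /orP[/orP[/orP[]|]|] /eqP->; rewrite ?fp ?fq eqxx ?orbT.
have SR : S \subset R by rewrite !subUset !sub1set pR fpR qR fqR.
(* When [f p] equals [q], the edge from [p] to [q] is in the matching, and the
   augmenting path is shorter. *)
pose s := if p == f q then [:: x; p; q; y] else [:: x; p; f p; f q; q; y].
have cp := e_col exp; have cq := e_col eyq; have cfp := e_col ep; have cfq := e_col eq.
rewrite cp negbK in cfp; rewrite cy negbK in cq; rewrite cq in cfq.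
have neqC z w : col z = col x -> col w = ~~ col x -> (z == w) = false.
  by move=> cz cw; apply/negP => /eqP E; move: cw; rewrite -E cz; case: (col x).
have nxy := neqC x y erefl cy.
have Ss z : (z \in s) = [|| z \in S, z == x | z == y].
  rewrite /s !inE; case: eqP => [E|_]; rewrite !inE ?E ?fq.
    by case: (z == x); case: (z == y); case: (z == q); case: (z == f q).
  by case: (z == x); case: (z == y); case: (z == q); case: (z == f q); case: (z == p); case: (z == f p).
have ms : matchable e [set z in s].
  have xz z : z \in R -> (x == z) = false by move=> zR; rewrite eq_sym neqR.
  have zy z : z \in R -> (z == y) = false by move=> zR; rewrite neqR.
  have neqe z w : e z w -> (z == w) = false by move=> /(e_neq)/negPf.
  have pq : (p == q) = false by rewrite eq_sym neqC.
  have eqq : e (f q) q by rewrite e_sym.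
  have eqy : e q y by rewrite e_sym.
  have xy : (x == y) = false by rewrite nxy.
  apply: matchable_path => //; rewrite /s; case: (p =P f q) => [E|/eqP/negPf NE] //=.
  - by rewrite exp {1}E eqq eqy.
  - by rewrite exp ep epq eqq eqy.
  - by rewrite !inE (xz p) // (xz q) // xy (zy p) // (zy q) // pq.
  - rewrite !inE (xz p) // (xz (f p)) // (xz (f q)) // (xz q) // xy (zy p) // (zy (f p)) //.
    rewrite (zy (f q)) // (zy q) // pq NE (neqe _ _ ep) (neqe _ _ eqq) (neqC (f p) (f q)) //= !orbF.
    by rewrite andbT; apply/negP => /eqP E; rewrite -E fp eqxx in NE.
clearbody S s.
have dis : [disjoint R :\: S & [set z in s]].
  rewrite -setI_eq0; apply/eqP/setP => z; rewrite !inE Ss.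
  have [->|_] := eqVneq z x; first by rewrite (negPf xR) andbF.
  have [->|_] := eqVneq z y; first by rewrite (negPf yR) andbF.
  by case: (z \in S); rewrite ?andbF.
have big_sub : (R :\: S) :|: [set z in s] \subset U.
  apply/subsetP => z; rewrite !inE Ss => /orP[/andP[_ /(subsetP RU)//]|].
  by case/or3P=> [/(subsetP SR)/(subsetP RU)//|/eqP->|/eqP->].
have big_sup : R \subset (R :\: S) :|: [set z in s].
  apply/subsetP => z zR; rewrite [z \in _ :|: _]inE [z \in _ :\: _]inE [z \in [set _ in _]]inE Ss zR andbT.
  by case: (z \in S).
have /subsetP/(_ x) := bigger _ (matchableU mD ms dis) big_sub big_sup.
by rewrite [x \in _ :|: _]inE [x \in [set _ in _]]inE Ss eqxx !orbT (negPf xR) => /(_ isT).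
Qed.

Lemma extend_to_spanning u v (L0 : seq T) : seg e u v L0 -> spare [::] L0 ->
    h <= (size L0)./2 \/ #|U| < size L0 + d.*2 ->
  exists L : seq T, [/\ seg e u v L, uniq L & L =i U].
Proof.
move=> sL0 cL0 big; pose P (L : seq T) := seg e u v L && spare [::] L.
have [|s /andP[_ /and5P[]]//|L [/andP[sL cL] mx]] := @ex_max_uniq_seq _ P L0.
  by rewrite /P sL0.
have le0 : size L0 <= size L by apply: mx; rewrite /P sL0.
have mL : maxpath u v L.
  by split=> // L' sL' cL'; apply: mx; rewrite /P sL'.
have big' : h <= (size L)./2 \/ #|U| < size L + d.*2.
  by case: big => b; [left|right]; move: le0 b; clear; lia.
have sub := maxpath_full mL big'.
have /and5P[_ uL _ /allP aL _] := cL.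
by exists L; split=> // x; apply/idP/idP => [/aL|/sub].
Qed.

(** The last vertex of a longest even path with matchable complement has all its
    neighbours on the path.  Cutting the path at the first of them leaves a cycle
    with at least [d] vertices of each colour, long enough to be extended. *)
Lemma spanning_cycle x : x \in U ->
  exists2 H : seq T, cycle e H & uniq H /\ H =i U.
Proof.
move=> xU; have mU : matchable e (U :\: [set z in [::]]).
  rewrite (_ : _ :\: _ = U) ?matchable_full //.
  by apply/setP => z; rewrite !inE.
have [Q [mQ Q0]] := ex_max_spare (L := [::]) isT mU (ex_intro2 _ _ x xU isT).
have [cQ _] := mQ; have /and5P[ssQ uQ eQ aQ mtQ] := cQ; rewrite !cat0s in uQ mtQ.
have sQ := segE x ssQ Q0; move: sQ; set a := nth x Q 0; set b := nth x Q _ => sQ.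
have := end_degree_last mQ sQ; rewrite add0n => bQ.
pose j := find (e b) Q.
have hasb : has (e b) Q by rewrite has_count; move: hd bQ; clear; lia.
have jN : j < size Q by rewrite -has_find.
have ebj : e b (nth x Q j) := nth_find x hasb.
pose L := drop j Q; have EQ : take j Q ++ L = Q := cat_take_drop j Q.
have sL : seg e (nth x Q j) b L.
  have := seg_slice x ssQ jN (leqnn _); rewrite /slice take_oversize ?size_drop //.
have oddj : ~~ odd j.
  have := e_col ebj; rewrite (nth_col e_col x ssQ jN) (seg_col e_col sQ eQ) negbK.
  by rewrite -/a; case: (col a); case: (odd j).
have sz : size L = size Q - j := size_drop j Q.
have evL : ~~ odd (size L) by rewrite sz oddB ?(ltnW jN) // (negPf oddj) (negPf eQ).
have bL : d <= count (e b) L.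
  move: bQ; rewrite -{1}EQ count_cat (_ : count _ (take j Q) = 0) //.
  apply/eqP; rewrite eqn0Ngt -has_count; apply/negP => /hasP[z zt ebz].
  have := index_ltn zt => lt; have := before_find x lt.
  by rewrite nth_index ?ebz // (mem_take zt).
have memQ z : (z \in Q) = (z \in take j Q) || (z \in L) by rewrite -mem_cat EQ.
have cL : spare [::] L.
  move: (uQ) (aQ) (ssQ); rewrite -EQ cat_uniq all_cat => /and3P[ut /hasPn dis uL] /andP[/allP at_ aL] ss.
  rewrite /spare (seg_sorted sL) /= uL evL aL /=.
  have -> : U :\: [set z in L] = (U :\: [set z in Q]) :|: [set z in take j Q].
    apply/setP => z; rewrite !inE memQ.
    case zt: (z \in take j Q); last by rewrite orbF.
    by rewrite orbT at_ // andbT; apply/negP => /dis; rewrite zt.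
  apply: matchableU => //.
    apply: matchable_path => //; first exact: sorted_take.
    by rewrite size_takel // ltnW.
  rewrite -setI_eq0; apply/eqP/setP => z; rewrite !inE memQ.
  by case: (z \in take j Q); rewrite ?andbF.
have big : h <= (size L)./2 \/ #|U| < size L + d.*2.
  left; have := count_nbr b (seg_sorted sL) evL.
  by move: hd bL; clear; lia.
have [H [sH uH HU]] := extend_to_spanning sL cL big.
exists H => //; case: H sH {uH HU} => // z H /and3P[/eqP-> /eqP lH pH].
by rewrite /= rcons_path pH lH.
Qed.

(** The two vertices split a spanning cycle of [U] into two arcs; the complement of
    each is a path with an even number of vertices, hence matchable, and the
    longer arc meets the size condition of the extension lemma. *)
Lemma laceable u v : u \in U -> v \in U -> col v = ~~ col u ->
  exists L : seq T, [/\ seg e u v L, uniq L & L =i U].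
Proof.
move=> uU vU cuv; have [H cH [uH HU]] := spanning_cycle uU.
have uHm : u \in H by rewrite HU.
have [i s Es] := rot_to uHm.
have {cH uH} : cycle e (u :: s) /\ uniq (u :: s) by rewrite -Es rot_cycle rot_uniq.
have {HU} sU : u :: s =i U by move=> z; rewrite -Es mem_rot HU.
have : v \in s.
  have := sU v; rewrite vU inE; case: eqP => // E.
  by move: cuv; rewrite E; case: (col u).
move=> vs; case/splitPr: s / vs sU {Es} => s1 s2 sU [].
rewrite [cycle _ _]/= rcons_cat rcons_cons cat_path /= => /and3P[p1 e1 p2].
rewrite rcons_path in p2; case/andP: p2 => p2 e2.
rewrite mem_cat inE negb_or => /andP[/andP[us1 /norP[uv us2]]].
rewrite cat_uniq /= => /and3P[us1' /norP[vs1 dis] /andP[vs2 us2']].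
have p1' : path e u (rcons s1 v) by rewrite rcons_path p1 e1.
have p2' : path e v (rcons s2 u) by rewrite rcons_path p2 e2.
pose A1 := u :: rcons s1 v; pose A2 := rev (v :: rcons s2 u).
have sA1 : seg e u v A1 by rewrite /A1 /seg last_rcons !eqxx p1'.
have sA2 : seg e u v A2 by apply: (seg_rev e_sym); rewrite /seg last_rcons !eqxx p2'.
have ev1 := seg_even e_col sA1 cuv; have ev2 := seg_even e_col sA2 cuv.
have sz1 : size A1 = (size s1).+2 by rewrite /= size_rcons.
have sz2 : size A2 = (size s2).+2 by rewrite size_rev /= size_rcons.
have uall : uniq [:: u, v & s1 ++ s2].
  by rewrite /= inE !mem_cat !negb_or uv us1 us2 vs1 vs2 cat_uniq us1' us2' /= dis.
have pm1 : perm_eq (A1 ++ s2) [:: u, v & s1 ++ s2].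
  by rewrite /A1 /= perm_cons cat_rcons (perm_catCA s1 [:: v] s2).
have pm2 : perm_eq (A2 ++ s1) [:: u, v & s1 ++ s2].
  rewrite /A2 rev_cons rev_rcons /= perm_cons cat_rcons.
  rewrite (perm_catCA _ [:: v] s1) /= perm_cons perm_catC.
  by rewrite perm_cat2l perm_rev.
have iU : [:: u, v & s1 ++ s2] =i U.
  by move=> z; rewrite -sU !inE !mem_cat !inE; case: (z == u); case: (z == v); rewrite ?orbT.
have cardU : #|U| = size s1 + size s2 + 2.
  by rewrite -(eq_card iU) (card_uniqP uall) /= size_cat; clear; lia.
have cA (A R : seq T) : sorted e A -> ~~ odd (size A) -> sorted e R -> ~~ odd (size R) ->
    perm_eq (A ++ R) [:: u, v & s1 ++ s2] -> spare [::] A.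
  move=> sA eA sR eR pm; move: uall; rewrite -(perm_uniq pm) => uAR.
  have iU' : A ++ R =i U by move=> z; rewrite (perm_mem pm) iU.
  move: (uAR); rewrite cat_uniq => /and3P[uA /hasPn disj uR].
  rewrite /spare sA /= uA eA /=; apply/andP; split.
    by apply/allP => z zA; rewrite /= -iU' mem_cat zA.
  rewrite (_ : _ :\: _ = [set z in R]) ?matchable_path //.
  apply/setP => z; rewrite !inE -iU' mem_cat.
  by case zR: (z \in R); rewrite ?orbT ?orbF ?andNb // (negPf (disj _ zR)).
have o1 : ~~ odd (size s1) by rewrite sz1 /= negbK in ev1.
have o2 : ~~ odd (size s2) by rewrite sz2 /= negbK in ev2.
have [le|lt] := leqP (size s2) (size s1).
  apply: (extend_to_spanning sA1 (cA _ _ (seg_sorted sA1) ev1 (path_sorted p2) o2 pm1)).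
  by rewrite cardU sz1; move: hd le; clear; case: (leqP h (size s1).+2./2); [left|right]; lia.
apply: (extend_to_spanning sA2 (cA _ _ (seg_sorted sA2) ev2 (path_sorted p1) o1 pm2)).
by rewrite cardU sz2; move: hd lt; clear; case: (leqP h (size s2).+2./2); [left|right]; lia.
Qed.

End Laceable.

(** * Walks as vectors over F_2 *)

Import GRing.Theory.
Section WalkVectors.
Variables (T : finType) (e : rel T).
Local Open Scope ring_scope.

Lemma addF2 (x : 'F_2) : x + x = 0.
Proof. by rewrite -mulr2n -mulr_natr (_ : 2%:R = 0 :> 'F_2) ?mulr0 //; apply: val_inj. Qed.

Lemma edge_space_add_self (v : edge_space e) : v + v = 0.
Proof. by apply/ffunP => d; rewrite !ffunE addF2. Qed.

(** This vector is zero when [x] and [y] are not adjacent, so that no adjacency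
    proof has to be carried along a walk. *)
Definition edge_vec (x y : T) : edge_space e := incidence e [set [set x; y]].

Lemma edge_vecC x y : edge_vec x y = edge_vec y x.
Proof. by rewrite /edge_vec setUC. Qed.

Fixpoint walk_vec (x : T) (s : seq T) : edge_space e :=
  if s is y :: t then edge_vec x y + walk_vec y t else 0.

(** The closing edge back to the first vertex is included. *)
Definition closed_vec (c : seq T) : edge_space e :=
  if c is x :: t then walk_vec x (rcons t x) else 0.

Lemma walk_vec_cat x s t : walk_vec x (s ++ t) = walk_vec x s + walk_vec (last x s) t.
Proof. by elim: s x => [|y s IH] x /=; rewrite ?add0r // IH addrA. Qed.

Lemma closed_vec_cat s t : closed_vec (s ++ t) = closed_vec (t ++ s).
Proof.
case: s t => [|a s] [|b t]; rewrite ?cats0 //= -!cats1 -!catA !walk_vec_cat /=.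
by rewrite !addr0 !addrA [LHS](ACl (3*4*1*2)).
Qed.

Lemma walk_vec_sum x s :
  walk_vec x s = \sum_(i < size s) edge_vec (nth x (x :: s) i) (nth x s i).
Proof.
elim: s x => [|y s IH] x /=; first by rewrite big_ord0.
rewrite big_ord_recl /= IH; congr (_ + _); apply: eq_bigr => i _ /=.
rewrite add0n; congr (edge_vec _ _); apply: set_nth_default; rewrite /= ?ltnS.
  exact: ltnW.
exact: ltn_ord.
Qed.

Lemma closed_vec_next c : uniq c -> closed_vec c = \sum_(x <- c) edge_vec x (next c x).
Proof.
case: c => [|x t] u; first by rewrite big_nil.
rewrite [LHS]walk_vec_sum (big_nth x) big_mkord size_rcons.
apply: eq_bigr => i _; have iN : (i < size (x :: t))%N := ltn_ord i.
rewrite next_nth mem_nth // index_uniq // -rcons_cons nth_rcons iN nth_rcons.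
by case: ltnP => le; rewrite ?if_same // [in RHS](nth_default x le).
Qed.

Lemma next_next_neq (c : seq T) x : uniq c -> (2 < size c)%N -> x \in c -> next c (next c x) != x.
Proof.
move=> u sz /rot_to[i s Es]; have u' : uniq (x :: s) by rewrite -Es rot_uniq.
have sz' : (2 < size (x :: s))%N by rewrite -Es size_rot.
rewrite -!(next_rot i u) Es.
case: s sz' u' {Es} => [|a [|b s]] //= _ /andP[]; rewrite !inE !negb_or => /and3P[xa xb _] _.
have ax : (a == x) = false by rewrite eq_sym (negPf xa).
by rewrite /= eqxx ax eqxx eq_sym.
Qed.

(** With only two vertices, both steps of the cycle would use the same edge. *)
Lemma cycle_edges_inj (c : seq T) : uniq c -> (2 < size c)%N ->
  {in c &, injective (fun x => [set x; next c x])}.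
Proof.
move=> u sz x y xc yc /= E; apply/eqP/negPn/negP => nxy.
have : x \in [set y; next c y] by rewrite -E !inE eqxx.
rewrite !inE (negPf nxy) /= => /eqP xE.
have : y \in [set x; next c x] by rewrite E !inE eqxx.
rewrite !inE eq_sym (negPf nxy) /= => /eqP yE.
by have := next_next_neq u sz xc; rewrite -yE -xE eqxx.
Qed.

Lemma incidence_cycle_edges c : is_cycle e c -> incidence e (cycle_edges c) = closed_vec c.
Proof.
case/and3P => sz _ u; rewrite closed_vec_next //; apply/ffunP => d.
rewrite ffunE sum_ffunE inE; under eq_bigr do rewrite ffunE inE.
rewrite -[RHS](big_map (fun x => [set x; next c x]) xpredT (fun f => (val d == f)%:R)).
have us : uniq [seq [set x; next c x] | x <- c].
  by rewrite map_inj_in_uniq //; apply: cycle_edges_inj.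
rewrite -natr_sum -(count_uniq_mem _ us) -sum1_count big_mkcond; congr (_%:R).
by apply: eq_bigr => f _; rewrite eq_sym /=; case: eqP.
Qed.
End WalkVectors.

(** * Short closed walks are sums of Hamilton cycles *)

Section Switching.
Variables (T : finType) (e : rel T) (col : pred T) (h d : nat).
Variable V : {vspace edge_space e}.
Hypothesis e_sym : symmetric e.
Hypothesis e_col : forall x y, e x y -> col y = ~~ col x.
Hypothesis no_hole : forall A B : {set T}, {in A, forall x, col x} ->
  {in B, forall x, ~~ col x} -> h <= #|A| -> h <= #|B| ->
  exists x y, [/\ x \in A, y \in B & e x y].
Hypothesis deg : forall x, d <= #|[set y | e x y]|.
Hypothesis hd : h + 11 <= d.
Hypothesis bal : #|[set x | col x]| = #|[set x | ~~ col x]|.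
Hypothesis hamV : forall c : seq T, uniq c -> cycle e c -> size c = #|T| ->
  closed_vec e c \in V.

(** A path whose ends have opposite colours has one end of each colour. *)
Lemma card_interior x y (p : seq T) c : seg e x y p -> uniq p -> col y = ~~ col x ->
  #|[set w in [set w in p] :\ x :\ y | col w == c]|.+1 = (size p)./2.
Proof.
move=> sp up cyx; rewrite -(count_col e_col c (seg_sorted sp) (seg_even e_col sp cyx)).
have -> : count (fun z => col z == c) p = #|[set w in p | col w == c]|.
  rewrite -size_filter -(card_uniqP (filter_uniq _ up)); apply: eq_card => w.
  by rewrite !inE mem_filter andbC.
pose w0 := if col x == c then x else y.
have w0p : w0 \in [set w in p | col w == c].
  have xp : x \in p by rewrite -(seg_head x sp) mem_nth ?(seg_gt0 sp).
  have yp : y \in p by rewrite -(seg_last x sp) mem_nth // prednK ?(seg_gt0 sp).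
  rewrite inE /w0; case: eqP => [->|]; first by rewrite xp eqxx.
  by rewrite yp cyx; case: (col x); case: c {w0}.
rewrite [RHS](cardsD1 w0) w0p add1n; congr _.+1; apply: eq_card => w; rewrite !inE /w0.
case: (eqVneq (col x) c) => [<-|nc].
  have [->|_] := eqVneq w y; last by case: (w == x); rewrite /= ?andbF.
  by rewrite cyx eqb_negLR; case: (col x); rewrite !andbF.
have [->|_] := eqVneq w x; last by rewrite andTb; case: (w == y).
by rewrite (negPf nc) !andbF.
Qed.

Local Open Scope ring_scope.

(** Both paths have at most nine vertices of each colour, so deleting the interior
    costs at most eight in every degree and keeps the graph balanced.  A path
    that spans the rest closes [s] and [s'] to Hamilton cycles, and cancels in
    their sum. *)
Lemma reroutings_congruent x y (s s' : seq T) : seg e x y (x :: s) -> seg e x y (x :: s') ->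
    perm_eq s s' -> uniq (x :: s) -> col y = ~~ col x -> (size s <= 17)%N ->
  walk_vec e x s + walk_vec e x s' \in V.
Proof.
move=> sp sp' pss up cyx sz.
pose I := [set w in x :: s] :\ x :\ y; pose U := ~: I.
have cI c : (#|[set w in I | col w == c]|.+1 = (size (x :: s))./2)%N := card_interior c sp up cyx.
have cI8 c : (#|[set w in I | col w == c]| <= 8)%N.
  by move: (cI c) sz => /=; clear; lia.
have cU (P : pred T) : (#|[set w | P w]| = #|[set w in I | P w]| + #|[set w in U | P w]|)%N.
  rewrite -(cardsID I); congr (_ + _)%N; apply: eq_card => w; rewrite !inE //.
    by rewrite andbC.
have degU z : z \in U -> (d - 8 <= #|[set w in U | e z w]|)%N.
  move=> _; have := deg z; rewrite cU.
  have : (#|[set w in I | e z w]| <= #|[set w in I | col w == ~~ col z]|)%N.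
    apply/subset_leq_card/subsetP => w; rewrite ![w \in [set _ in _ | _]]inE => /andP[-> /e_col ->].
    by rewrite eqxx.
  by move: (cI8 (~~ col z)); clear; lia.
have balU : #|[set w in U | col w]| = #|[set w in U | ~~ col w]|.
  have := cU col; have := cU (fun w => ~~ col w); rewrite bal.
  by have := cI true; have := cI false; rewrite !set_col; clear; lia.
have hd' : (h + 2 <= d - 8)%N by move: hd; clear; lia.
have xU : x \in U by rewrite !inE eqxx /= andbF.
have yU : y \in U by rewrite !inE eqxx.
have cxy : col x = ~~ col y by rewrite cyx negbK.
have [L [sL uL LU]] := laceable e_sym e_col no_hole degU hd' balU yU xU cxy.
have nxy : x != y by apply/eqP => E; move: cyx; rewrite E; case: (col y).
case: L sL uL LU => // y' L /and3P[/eqP-> lL pL] uL LU.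
case/lastP: L lL pL uL LU => [/eqP /= Exy|L x']; first by rewrite Exy eqxx in nxy.
rewrite last_rcons => /eqP-> pL uL LU.
have lasts t : seg e x y (x :: t) -> last x t = y by case/and3P=> _ /eqP.
have closed t : seg e x y (x :: t) -> closed_vec e (x :: t ++ L) = walk_vec e x t + walk_vec e y (rcons L x).
  by move=> st; rewrite /= rcons_cat walk_vec_cat lasts.
have sumU : walk_vec e x s + walk_vec e x s' = closed_vec e (x :: s ++ L) + closed_vec e (x :: s' ++ L).
  by rewrite !closed // addrACA edge_space_add_self addr0.
have pathL t : seg e x y (x :: t) -> cycle e (x :: t ++ L).
  by move=> st; rewrite /= rcons_cat cat_path lasts // pL andbT; case/and3P: st.
have us : uniq (x :: s ++ L).
  move: uL; rewrite /= rcons_uniq mem_rcons inE eq_sym (negPf nxy) /= => /and3P[yL xL uL].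
  move: up; rewrite /= mem_cat (negPf xL) orbF cat_uniq uL andbT => /andP[-> ->] /=.
  apply/hasPn => w wL; apply/negP => ws.
  have := LU w; rewrite inE mem_rcons inE wL !orbT => /esym.
  rewrite !inE ws orbT andbT negb_and !negbK => /orP[/eqP E|/eqP E].
    by rewrite -E wL in yL.
  by rewrite -E wL in xL.
have full : (size (x :: s ++ L) = #|T|)%N.
  rewrite -(card_uniqP us); apply: eq_card => w; rewrite !inE mem_cat.
  have ys : y \in s by have := mem_last x s; rewrite lasts // inE eq_sym (negPf nxy).
  have := LU w; rewrite !inE mem_rcons inE.
  have [->|_] := eqVneq w y; first by rewrite ys orbT.
  by case: (w == x); case: (w \in s); case: (w \in L).
rewrite sumU; apply: memvD; apply: hamV => //; try exact: pathL.
  have pm : perm_eq (x :: s ++ L) (x :: s' ++ L) by rewrite perm_cons perm_cat2r.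
  by rewrite -(perm_uniq pm).
by rewrite -full /= !size_cat (perm_size pss).
Qed.

Lemma card_nbr_avoid w (F : seq T) k :
  (count (fun z => col z == ~~ col w) F <= k)%N ->
  (d - k <= #|[set z | e w z & z \notin F]|)%N.
Proof.
move=> cF; have := deg w; rewrite -(cardsID [set z in F]).
have le : (#|[set z | e w z] :&: [set z in F]| <= k)%N.
  apply: leq_trans cF; rewrite -size_filter; apply: leq_trans (card_size _).
  apply/subset_leq_card/subsetP => z; rewrite !inE mem_filter => /andP[/e_col -> ->].
  by rewrite eqxx.
rewrite (_ : _ :\: _ = [set z | e w z & z \notin F]); last first.
  by apply/setP => z; rewrite !inE andbC.
by move: le; clear; lia.
Qed.

Lemma nbr_avoid w (F : seq T) : (forall c, count (fun z => col z == c) F <= 10)%N ->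
  exists2 z, e w z & z \notin F.
Proof.
move=> cF; have := card_nbr_avoid (cF (~~ col w)).
case: (set_0Vmem [set z | e w z & z \notin F]) => [->|[z]].
  by rewrite cards0; move: hd; clear; lia.
by rewrite inE => /andP[? ?]; exists z.
Qed.

(** The last interior vertex is chosen among the neighbours of [w'], and the other
    two as an edge between the neighbours of [w] and those of that vertex.  The
    count of colours in the conclusion is what the next link needs. *)
Lemma four_edge_link w w' (F : seq T) : col w' = col w -> uniq F ->
    (forall c, count (fun z => col z == c) F <= 8)%N ->
  exists a b c, [/\ path e w [:: a; b; c; w'], uniq [:: a, b, c & F] &
    forall k, (count (fun z => col z == k) [:: a, b, c & F] <=
               2 + count (fun z => col z == k) F)%N].
Proof.
move=> cw uF cF.
have [|a' ea' a'F] := @nbr_avoid w' F; first by move=> c; apply: leq_trans (cF c) _.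
have cA : (h <= #|[set z | e w z & z \notin F] :\ a'|)%N.
  have := card_nbr_avoid (cF (~~ col w)); rewrite (cardsD1 a').
  by move: hd; case: (a' \in _); clear; lia.
have cB : (h <= #|[set z | e a' z & z \notin F]|)%N.
  by have := card_nbr_avoid (cF (~~ col a')); move: hd; clear; lia.
rewrite cardE in cA; rewrite cardE in cB.
have colA : {in enum ([set z | e w z & z \notin F] :\ a'), forall z, col z = ~~ col w}.
  by move=> z; rewrite mem_enum !inE => /and3P[_ /e_col].
have colB : {in enum [set z | e a' z & z \notin F], forall z, col z = ~~ ~~ col w}.
  by move=> z; rewrite mem_enum !inE => /andP[/e_col -> _]; rewrite (e_col ea') cw.
have [a [b [aA bB eab]]] := no_hole_seq e_sym no_hole (enum_uniq _) (enum_uniq _) colA colB cA cB.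
have ca := colA _ aA; have cb := colB _ bB.
move: aA bB; rewrite !mem_enum !inE => /and3P[aa' ewa aF] /andP[ea'b bF].
exists a, b, a'; split.
- by rewrite /= ewa eab [e b a']e_sym ea'b [e a' w']e_sym ea'.
- rewrite /= !inE !negb_or aa' aF bF a'F uF (e_neq e_col eab) !andbT /=.
  by rewrite eq_sym (e_neq e_col ea'b).
- move=> k /=; rewrite ca cb; case: (col w); case: k; case: (col a' == _) => //=; lia.
Qed.

(** Links join [v2] to [v8], [v3] to [v7] and [v4] to [v6].  The two paths from [v1]
    run through all three links, one with the edges [v1 v2], [v3 v4], [v5 v6] and
    [v7 v8], the other with the remaining edges of the octagon.  A final edge from
    [v5] to [y] gives the ends opposite colours.  Each link takes at most two
    vertices of either colour, so at most eight of a colour are to be avoided by the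
    last link and at most ten by the final edge. *)
Lemma octagon_mem v1 v2 v3 v4 v5 v6 v7 v8 :
  uniq [:: v1; v2; v3; v4; v5; v6; v7; v8] ->
  cycle e [:: v1; v2; v3; v4; v5; v6; v7; v8] ->
  closed_vec e [:: v1; v2; v3; v4; v5; v6; v7; v8] \in V.
Proof.
set F := [:: v1; _; _; _; _; _; _; _] => uF cyc.
have /and5P[e12 e23 e34 e45 /and5P[e56 e67 e78 e81 _]] := cyc.
have so : sorted e F by rewrite /= e12 e23 e34 e45 e56 e67 e78.
have cF k : (count (fun z => col z == k) F = 4)%N by rewrite (count_col e_col).
have c2 := e_col e12; have c3 := e_col e23; have c4 := e_col e34; have c5 := e_col e45.
have c6 := e_col e56; have c7 := e_col e67; have c8 := e_col e78.
rewrite c2 negbK in c3; rewrite c3 in c4; rewrite c4 negbK in c5; rewrite c5 in c6.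
rewrite c6 negbK in c7; rewrite c7 in c8.
have [||a1 [b1 [d1 [p1 u1 k1]]]] := @four_edge_link v2 v8 F _ uF; first by rewrite c8 c2.
  by move=> k; rewrite cF.
have [||a2 [b2 [d2 [p2 u2 k2]]]] := @four_edge_link v3 v7 _ _ u1; first by rewrite c7 c3.
  by move=> k; apply: leq_trans (k1 k) _; rewrite cF.
have [||a3 [b3 [d3 [p3 u3 k3]]]] := @four_edge_link v4 v6 _ _ u2; first by rewrite c6 c4.
  by move=> k; apply: leq_trans (k2 k) _; rewrite (leq_add2l 2 _ 6) (leq_trans (k1 k)) // cF.
have [|y e5y yF] := @nbr_avoid v5 [:: a3, b3, d3, a2, b2, d2, a1, b1, d1 & F].
  move=> k; apply: leq_trans (k3 k) _; rewrite (leq_add2l 2 _ 8) (leq_trans (k2 k)) //.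
  by rewrite (leq_add2l 2 _ 6) (leq_trans (k1 k)) // cF.
have uall := conj yF u3.
pose p := [:: v2; a1; b1; d1; v8; v7; d2; b2; a2; v3; v4; a3; b3; d3; v6; v5; y].
pose p' := [:: v8; d1; b1; a1; v2; v3; a2; b2; d2; v7; v6; d3; b3; a3; v4; v5; y].
have pp : perm_eq p p'.
  by apply/permP => P /=; rewrite /p /p' /=; ring.
have pu : perm_eq (v1 :: p) (y :: [:: a3, b3, d3, a2, b2, d2, a1, b1, d1 & F]).
  by apply/permP => P /=; rewrite /p /F /=; ring.
have up : uniq (v1 :: p) by rewrite (perm_uniq pu) cons_uniq; apply/andP.
move: p1 p2 p3 => /and5P[e2a1 a1b1 b1d1 d18 _] /and5P[e3a2 a2b2 b2d2 d27 _] /and5P[e4a3 a3b3 b3d3 d36 _].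
have sp : seg e v1 y (v1 :: p).
  rewrite /seg /= !eqxx e12 e2a1 a1b1 b1d1 d18 e34 e4a3 a3b3 b3d3 d36 e5y /=.
  by rewrite ![e v8 _]e_sym e78 [e v7 _]e_sym d27 [e d2 _]e_sym b2d2 [e b2 _]e_sym a2b2 [e a2 _]e_sym e3a2 [e v6 _]e_sym e56.
have sp' : seg e v1 y (v1 :: p').
  rewrite /seg /= !eqxx e5y e23 e3a2 a2b2 b2d2 d27 e45 /=.
  rewrite [e v1 _]e_sym e81 [e v8 _]e_sym d18 [e d1 _]e_sym b1d1 [e b1 _]e_sym a1b1 [e a1 _]e_sym e2a1.
  by rewrite [e v7 _]e_sym e67 [e v6 _]e_sym d36 [e d3 _]e_sym b3d3 [e b3 _]e_sym a3b3 [e a3 _]e_sym e4a3.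
have cy : col y = ~~ col v1 by rewrite (e_col e5y) c5.
suff <- : walk_vec e v1 p + walk_vec e v1 p' = closed_vec e F.
  by apply: reroutings_congruent sp sp' pp up cy isT.
have E := edge_vecC e; rewrite /p /p' /F /=.
rewrite (E v8 d1) (E d1 b1) (E b1 a1) (E a1 v2) (E v7 d2) (E d2 b2) (E b2 a2) (E a2 v3).
rewrite (E v6 d3) (E d3 b3) (E b3 a3) (E a3 v4) (E v8 v7) (E v6 v5) (E v1 v8) (E v7 v6).
(* The edges of the octagon come first; all other edges are paired with themselves. *)
rewrite !addr0 !addrA [LHS](ACl (1*23*11*33*16*28*6*18*(2*22)*(3*21)*(4*20)*(5*19)*(7*27)*(8*26)*(9*25)
  *(10*24)*(12*32)*(13*31)*(14*30)*(15*29)*(17*34))) /=.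
by rewrite !edge_space_add_self !addr0.
Qed.

(** A path of five edges joins the antipodal vertices [v1] and [v4] outside the
    hexagon, and forms an octagon with either half of it. *)
Lemma hexagon_mem v1 v2 v3 v4 v5 v6 :
  uniq [:: v1; v2; v3; v4; v5; v6] -> cycle e [:: v1; v2; v3; v4; v5; v6] ->
  closed_vec e [:: v1; v2; v3; v4; v5; v6] \in V.
Proof.
set F := [:: v1; _; _; _; _; _] => uF cyc.
have /and5P[e12 e23 e34 e45 /and3P[e56 e61 _]] := cyc.
have so : sorted e F by rewrite /= e12 e23 e34 e45 e56.
have cF k : (count (fun z => col z == k) F = 3)%N by rewrite (count_col e_col).
have [|y e4y yF] := @nbr_avoid v4 F; first by move=> k; rewrite cF.
have cy : col y = col v1.
  by rewrite (e_col e4y) (e_col e34) (e_col e23) (e_col e12) !negbK.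
have uyF : uniq (y :: F) by rewrite cons_uniq yF.
have [|a [b [c [p u _]]]] := four_edge_link cy uyF.
  by move=> k /=; have := cF k; rewrite /= => ->; case: (col y == k).
move: p => /and5P[e1a eab ebc ecy _].
have o1 : closed_vec e [:: v1; v2; v3; v4; y; c; b; a] \in V.
  apply: octagon_mem.
    have pu : perm_eq ([:: v1; v2; v3; v4; y; c; b; a] ++ [:: v5; v6]) [:: a, b, c, y & F].
      by apply/permP => P; rewrite /F /=; ring.
    by move: u; rewrite -(perm_uniq pu) cat_uniq => /andP[].
  by rewrite /= e12 e23 e34 e4y [e y c]e_sym ecy [e c b]e_sym ebc [e b a]e_sym eab [e a v1]e_sym e1a.
have o2 : closed_vec e [:: v1; v6; v5; v4; y; c; b; a] \in V.
  apply: octagon_mem.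
    have pu : perm_eq ([:: v1; v6; v5; v4; y; c; b; a] ++ [:: v2; v3]) [:: a, b, c, y & F].
      by apply/permP => P; rewrite /F /=; ring.
    by move: u; rewrite -(perm_uniq pu) cat_uniq => /andP[].
  rewrite /= [e v1 _]e_sym e61 [e v6 _]e_sym e56 [e v5 _]e_sym e45 e4y [e y c]e_sym ecy.
  by rewrite [e c b]e_sym ebc [e b a]e_sym eab [e a v1]e_sym e1a.
suff -> : closed_vec e F = closed_vec e [:: v1; v2; v3; v4; y; c; b; a] +
                           closed_vec e [:: v1; v6; v5; v4; y; c; b; a] by apply: memvD.
have E := edge_vecC e; rewrite /F /= (E v1 v6) (E v6 v5) (E v5 v4).
rewrite !addr0 !addrA [RHS](ACl (1*2*3*11*10*9*(4*12)*(5*13)*(6*14)*(7*15)*(8*16))) /=.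
by rewrite !edge_space_add_self !addr0.
Qed.

(** A link joins [v1] and [v3] outside the quadrangle, and forms a hexagon with
    either half of it. *)
Lemma quadrangle_mem v1 v2 v3 v4 :
  uniq [:: v1; v2; v3; v4] -> cycle e [:: v1; v2; v3; v4] ->
  closed_vec e [:: v1; v2; v3; v4] \in V.
Proof.
set F := [:: v1; _; _; _] => uF cyc.
have /and5P[e12 e23 e34 e41 _] := cyc.
have so : sorted e F by rewrite /= e12 e23 e34.
have cF k : (count (fun z => col z == k) F = 2)%N by rewrite (count_col e_col).
have cy : col v3 = col v1 by rewrite (e_col e23) (e_col e12) !negbK.
have [|a [b [c [p u _]]]] := four_edge_link cy uF; first by move=> k; rewrite cF.
move: p => /and5P[e1a eab ebc ecy _].
have o1 : closed_vec e [:: v1; v2; v3; c; b; a] \in V.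
  apply: hexagon_mem.
    have pu : perm_eq ([:: v1; v2; v3; c; b; a] ++ [:: v4]) [:: a, b, c & F].
      by apply/permP => P; rewrite /F /=; ring.
    by move: u; rewrite -(perm_uniq pu) cat_uniq => /andP[].
  by rewrite /= e12 e23 [e v3 c]e_sym ecy [e c b]e_sym ebc [e b a]e_sym eab [e a v1]e_sym e1a.
have o2 : closed_vec e [:: v1; v4; v3; c; b; a] \in V.
  apply: hexagon_mem.
    have pu : perm_eq ([:: v1; v4; v3; c; b; a] ++ [:: v2]) [:: a, b, c & F].
      by apply/permP => P; rewrite /F /=; ring.
    by move: u; rewrite -(perm_uniq pu) cat_uniq => /andP[].
  rewrite /= [e v1 _]e_sym e41 [e v4 _]e_sym e34 [e v3 c]e_sym ecy.
  by rewrite [e c b]e_sym ebc [e b a]e_sym eab [e a v1]e_sym e1a.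
suff -> : closed_vec e F = closed_vec e [:: v1; v2; v3; c; b; a] +
                           closed_vec e [:: v1; v4; v3; c; b; a] by apply: memvD.
have E := edge_vecC e; rewrite /F /= (E v1 v4) (E v4 v3).
rewrite !addr0 !addrA [RHS](ACl (1*2*8*7*(3*9)*(4*10)*(5*11)*(6*12))) /=.
by rewrite !edge_space_add_self !addr0.
Qed.

Lemma cycle_even (c : seq T) : cycle e c -> ~~ odd (size c).
Proof.
case: c => // x t cyc.
have := nth_col e_col x (s := x :: rcons t x) (i := (size t).+1) cyc.
rewrite /= size_rcons nth_rcons ltnn eqxx => /(_ (ltnSn _)).
by case: (col x); case: (odd _).
Qed.

Lemma short_cycle_mem (c : seq T) : cycle e c -> uniq c -> (size c < 10)%N ->
  closed_vec e c \in V.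
Proof.
move=> cyc; have := cycle_even cyc.
case: c cyc => [|v1 [|v2 [|v3 [|v4 [|v5 [|v6 [|v7 [|v8 [|v9 [|v10 c]]]]]]]]]] // cyc _ uc _.
- exact: mem0v.
- by rewrite /= addr0 (edge_vecC e v2 v1) edge_space_add_self mem0v.
- exact: quadrangle_mem.
- exact: hexagon_mem.
- exact: octagon_mem.
Qed.

Lemma cycle_repeat x (s t : seq T) :
  cycle e (x :: s ++ x :: t) = cycle e (x :: s) && cycle e (x :: t).
Proof. by rewrite /= rcons_cat -cat_rcons cat_path last_rcons. Qed.

Lemma closed_vec_repeat x (s t : seq T) :
  closed_vec e (x :: s ++ x :: t) = closed_vec e (x :: s) + closed_vec e (x :: t).
Proof. by rewrite /= rcons_cat -cat_rcons walk_vec_cat last_rcons. Qed.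

(** A closed walk of length at least ten is split by a walk of three edges from its
    vertex [v0] to its vertex [v5] into one of length eight and one shorter by
    two.  A shorter closed walk either repeats a vertex, and splits there, or is a
    cycle of length at most eight or a single edge traversed twice. *)
Lemma closed_walk_mem (c : seq T) : cycle e c -> closed_vec e c \in V.
Proof.
have [n] := ubnP (size c); elim: n c => // n IH c lt cyc.
have [sz|sz] := ltnP (size c) 10.
  have [uc|] := boolP (uniq c); first exact: short_cycle_mem.
  case: (c) lt cyc sz => // x0 c' lt cyc sz /(uniqPn x0)[i [j [ij jN Exy]]].
  move: (slice3 (ltnW ij) (ltnW jN)); set c0 := x0 :: c' in lt cyc sz jN *.
  have -> : slice i j c0 = nth x0 c0 i :: slice i.+1 j c0.
    rewrite -(@slice_cat _ i i.+1 j) // -[RHS]cat1s; congr (_ ++ _).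
    by rewrite /slice subSnn (drop_nth x0) ?take_cons ?take0 // (ltn_trans ij).
  have -> : slice j (size c0) c0 = nth x0 c0 i :: slice j.+1 (size c0) c0.
    rewrite -(@slice_cat _ j j.+1) // Exy -[RHS]cat1s; congr (_ ++ _).
    by rewrite /slice subSnn (drop_nth x0) ?take_cons ?take0.
  move: (nth x0 c0 i) (slice 0 i c0) (slice i.+1 j c0) (slice j.+1 (size c0) c0) => x s0 s1 s2 Ec.
  have Er : rot (size s0) c0 = x :: s1 ++ x :: (s2 ++ s0) by rewrite Ec rot_size_cat /= -catA.
  have szr : (size c0 = (size s1).+1 + (size (s2 ++ s0)).+1)%N.
    by rewrite -(size_rot (size s0)) Er /= size_cat /= addSn.
  have -> : closed_vec e c0 = closed_vec e (rot (size s0) c0).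
    by rewrite Ec rot_size_cat closed_vec_cat.
  rewrite Er closed_vec_repeat.
  move: cyc; rewrite -(rot_cycle (size s0)) Er cycle_repeat => /andP[cyc1 cyc2].
  by apply: memvD; apply: IH => //; move: lt; rewrite szr /=; clear; lia.
case: c lt cyc sz => [|v0 [|v1 [|v2 [|v3 [|v4 [|v5 t]]]]]] // lt.
move=> /and5P[e01 e12 e23 e34 /andP[e45 pt]] sz; rewrite /= in lt sz.
have c5 : col v5 = ~~ col v0.
  by rewrite (e_col e45) (e_col e34) (e_col e23) (e_col e12) (e_col e01) !negbK.
have big z : (h <= size (enum [set w | e z w]))%N.
  by rewrite -cardE; apply: leq_trans (deg z); move: hd; clear; lia.
have col0 : {in enum [set w | e v0 w], forall w, col w = ~~ col v0}.
  by move=> w; rewrite mem_enum inE => /e_col.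
have col5 : {in enum [set w | e v5 w], forall w, col w = ~~ ~~ col v0}.
  by move=> w; rewrite mem_enum inE => /e_col ->; rewrite c5.
have [p [q []]] := no_hole_seq e_sym no_hole (enum_uniq _) (enum_uniq _) col0 col5 (big v0) (big v5).
rewrite !mem_enum !inE => e0p e5q epq.
have c8 : closed_vec e [:: v0; v1; v2; v3; v4; v5; q; p] \in V.
  apply: IH => /=; first by move: lt sz; clear; lia.
  by rewrite e01 e12 e23 e34 e45 e5q [e q p]e_sym epq [e p v0]e_sym e0p.
have cr : closed_vec e [:: v0, p, q, v5 & t] \in V.
  apply: IH => /=; first by move: lt; clear; lia.
  by rewrite e0p epq [e q v5]e_sym e5q (pt : path e v5 (rcons t v0)).
suff -> : closed_vec e [:: v0, v1, v2, v3, v4, v5 & t] =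
    closed_vec e [:: v0; v1; v2; v3; v4; v5; q; p] + closed_vec e [:: v0, p, q, v5 & t].
  exact: memvD.
have E := edge_vecC e; rewrite /= (E v0 p) (E p q) (E q v5).
rewrite !addr0 !addrA [RHS](ACl (1*2*3*4*5*12*(6*11)*(7*10)*(8*9))) /=.
by rewrite !edge_space_add_self !addr0.
Qed.

End Switching.

(** * The theorem *)

Lemma min_degree_le (T : finType) (e : rel T) x : min_degree e <= degree e x.
Proof.
rewrite /min_degree; have : x \in index_enum T by rewrite mem_index_enum.
elim: (index_enum T) => // y s IH; rewrite inE big_cons => /orP[/eqP->|/IH le].
  exact: geq_minl.
exact: leq_trans (geq_minr _ _) le.
Qed.

(** Without such an edge, [k] vertices of [A] and [k] vertices of [B] would form a
    balanced independent set. *)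
Lemma edge_between (T : finType) (e : rel T) (X Y A B : {set T}) (k : nat) :
    symmetric e -> bipartite e X Y -> alpha_BIP e X Y < k.*2 ->
    A \subset X -> B \subset Y -> k <= #|A| -> k <= #|B| ->
  exists x y, [/\ x \in A, y \in B & e x y].
Proof.
move=> e_sym /and4P[_ XY iX iY] lt AX BY kA kB.
have [/existsP[x /existsP[y /and3P[xA yB exy]]]|no] :=
  boolP [exists x, exists y, [&& x \in A, y \in B & e x y]]; first by exists x, y.
have noe x y : x \in A -> y \in B -> ~~ e x y.
  move=> xA yB; apply: contra no => exy.
  by apply/existsP; exists x; apply/existsP; exists y; rewrite xA yB.
have shrink (S : {set T}) : k <= #|S| -> exists2 S' : {set T}, S' \subset S & #|S'| = k.
  move=> kS; exists [set x in take k (enum S)].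
    by apply/subsetP => x; rewrite inE => /mem_take; rewrite mem_enum.
  by rewrite cardsE (card_uniqP (take_uniq _ (enum_uniq _))) size_takel // -cardE.
have [A' A'A cA'] := shrink A kA; have [B' B'B cB'] := shrink B kB.
have A'X := subset_trans A'A AX; have B'Y := subset_trans B'B BY.
have dAB : [disjoint A' & B'] by apply: disjointWl A'X (disjointWr B'Y XY).
suff : k.*2 <= alpha_BIP e X Y by rewrite leqNgt lt.
have <- : #|A' :|: B'| = k.*2.
  by rewrite cardsU (disjoint_setI0 dAB) cards0 subn0 cA' cB' addnn.
apply: (@leq_bigmax_cond _ _ (fun S : {set T} => #|S|)); apply/andP; split.
  have indep (S : {set T}) x y : independent e S -> x \in S -> y \in S -> ~~ e x y.
    by move=> /forall_inP/(_ x) + xS => /(_ xS)/forall_inP; apply.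
  apply/forall_inP => x xS; apply/forall_inP => y yS; move: xS yS; rewrite !inE.
  move=> /orP[xA|xB] /orP[yA|yB].
  - exact: indep iX (subsetP A'X _ xA) (subsetP A'X _ yA).
  - exact: noe (subsetP A'A _ xA) (subsetP B'B _ yB).
  - by rewrite e_sym; apply: noe (subsetP A'A _ yA) (subsetP B'B _ xB).
  - exact: indep iY (subsetP B'Y _ xB) (subsetP B'Y _ yB).
rewrite !setIUl (setIidPl A'X) (setIidPl B'Y).
have -> : B' :&: X = set0.
  by apply/eqP; rewrite setI_eq0 disjoint_sym; apply: disjointWr B'Y XY.
have -> : A' :&: Y = set0 by apply/eqP; rewrite setI_eq0; apply: disjointWl A'X XY.
by rewrite setU0 set0U cA' cB'.
Qed.

Theorem theorem1p13 (T : finType) (e : rel T) (X Y : {set T}) (n : nat)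
    (e_sym : symmetric e) (e_irr : irreflexive e)
    (bipXY : balanced_bipartite e X Y) (cardT : #|T| = 2 * n)
    (alpha_le :
      ((alpha_BIP e X Y)%:Z <= 2%:Z * (min_degree e)%:Z - 24%:Z)%R) :
  cycle_space_of_length e (2 * n) = cycle_space e.
Proof.
have /andP[bip /eqP cXY] := bipXY; have /and4P[/eqP cover XY iX iY] := bip.
have alpha_lt : alpha_BIP e X Y < (min_degree e - 11).*2 by lia.
have d_big : 12 <= min_degree e by lia.
have memY x : (x \in Y) = (x \notin X).
  have := in_setT x; rewrite -cover inE.
  by have := disjointFr XY (x := x); case: (x \in X) => [->|_ /= ->].
have indep (S : {set T}) x y : independent e S -> e x y -> x \in S -> y \in S -> False.
  by move=> /forall_inP/(_ x) + exy xS => /(_ xS)/forall_inP/(_ y) no /no; rewrite exy.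
pose col : pred T := fun x => x \in X.
have e_col x y : e x y -> col y = ~~ col x.
  move=> exy; rewrite /col; case xX: (x \in X).
    by apply/negP => yX; apply: indep iX exy xX yX.
  by apply/negPn/negP => yX; apply: (indep _ _ _ iY exy); rewrite memY ?xX.
have no_hole (A B : {set T}) : {in A, forall x, col x} -> {in B, forall x, ~~ col x} ->
    min_degree e - 11 <= #|A| -> min_degree e - 11 <= #|B| ->
    exists x y, [/\ x \in A, y \in B & e x y].
  move=> cA cB; apply: edge_between e_sym bip alpha_lt _ _.
    by apply/subsetP => x /cA.
  by apply/subsetP => x /cB; rewrite memY.
have deg x : min_degree e <= #|[set y | e x y]| := min_degree_le e x.
have hd : min_degree e - 11 + 11 <= min_degree e by rewrite subnK // ltnW.
have bal : #|[set x | col x]| = #|[set x | ~~ col x]|.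
  have -> : [set x | col x] = X by apply/setP => x; rewrite inE.
  have -> : [set x | ~~ col x] = Y by apply/setP => x; rewrite inE memY.
  exact: cXY.
have cardT_gt : 2 < #|T|.
  have [T0|] := posnP #|T|.
    suff : min_degree e <= 0 by move: d_big; clear; lia.
    rewrite /min_degree -T0; elim/big_rec: _ => // x m _ le.
    exact: leq_trans (geq_minr _ _) le.
  case/card_gt0P=> x _; have := leq_trans d_big (deg x).
  by have := max_card [set y | e x y]; clear; lia.
pose V := cycle_space_of_length e (2 * n).
have hamV c : uniq c -> cycle e c -> size c = #|T| -> closed_vec e c \in V.
  move=> uc cyc sz; have ic : is_cycle e c by rewrite /is_cycle /ucycleb sz cardT_gt cyc uc.
  rewrite -incidence_cycle_edges //; apply: memv_span.
  have szb : size c <= #|T| by rewrite sz.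
  apply/imageP; exists (Bseq szb) => //.
  by rewrite inE /= ic sz cardT eqxx.
apply/eqP; rewrite eqEsubv; apply/andP; split.
  apply: sub_span => v /imageP[c]; rewrite inE => /andP[ic _] ->.
  by apply/imageP; exists c.
apply/span_subvP => _ /imageP[c /[!inE] ic ->].
rewrite incidence_cycle_edges //; apply: (closed_walk_mem e_sym e_col no_hole deg hd bal hamV).
by case/and3P: ic.
Qed.
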